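(* Let $\ell=2$, $q$ odd, $4\mid q+\eta$ and $\mathbf c\ne\mathbf 0$. Let $\tilde R=\tilde R_{m,\alpha,\gamma,\mathbf c}$ (except $\alpha=\gamma=0$, $c_1=1$) or $\tilde R=\tilde R^\pm_{m,0,\gamma,\mathbf c}$ ($\gamma>1$ if the type is plus, $\gamma>0$ if the type is minus) be a basic subgroup of $\tilde G_{m,\alpha,\gamma,\mathbf c}=\mathrm{GL}_{m2^{\alpha+\gamma+|\mathbf c|}}(\eta q)$ (with $\alpha=0$ in the second case), and suppose $\tilde R$ is a radical $2$-subgroup. Then $\tilde R$ is special with respect to $\mathrm{SL}_{m2^{\alpha+\gamma+|\mathbf c|}}(\eta q)$, unless $\tilde R=\tilde R_{m,0,0,(2)}$.
   Context: Let $p$ be an odd prime, $q$ a power of $p$, $\eta\in\{1,-1\}$ with $4\mid q+\eta$, $\overline{\mathbb F}$ an algebraic closure of $\mathbb F_q$. On $\mathrm{GL}_N(\overline{\mathbb F})$ let $F$ be $A\mapsto A^{(q)}$ (entrywise $q$-th powers) if $\eta=1$, and $A\mapsto((A^{(q)})^{-1})^t$ if $\eta=-1$. $\mathrm{GL}_N((\eta q)^k)$ denotes the fixed points of $F^k$; so $\mathrm{GL}_N(\eta q)$ is $\mathrm{GL}_N(q)$ or $\mathrm{GU}_N(q)$, and $\mathrm{SL}_N(\eta q)$ is its subgroup of determinant 1. $a\ge2$ is defined by $2^{a}=(q+\eta)_2$. Tensor product of matrices: $A\otimes B=(b_{ij}A)$. Let $x=\mathrm{diag}(1,-1)$, $y=\begin{pmatrix}0&1\\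 1&0\end{pmatrix}$; $x_j,y_j$ ($1\le j\le\gamma$) are the $\gamma$-fold tensor products with $x$, resp. $y$, in position $j$ and $I_2$ elsewhere. Let $m\ge1$. - For $\alpha>0$, $\gamma\ge0$: fix $\zeta\in\overline{\mathbb F}^\times$ of order $2^{a+\alpha}$, $R^0=\langle\zeta I_{m2^\gamma},I_m\otimes x_j,I_m\otimes y_j:1\le j\le\gamma\rangle\le\mathrm{GL}_{m2^\gamma}((\eta q)^{2^\alpha})$, $k=2^\alpha$, choose $g_\alpha\in\mathrm{SL}_k(\overline{\mathbb F})$ with $g_\alpha^{-1}F(g_\alpha)=\begin{pmatrix}0&-1\\ I_{k-1}&0\end{pmatrix}$, $g=I_{m2^\gamma}\otimes g_\alpha$; $\tilde R_{m,\alpha,\gamma}=\{g\,\mathrm{diag}(A,F(A),\dots,F^{k-1}(A))\,g^{-1}:A\in R^0\}\le\mathrm{GL}_{m2^{\alpha+\gamma}}(\eta q)$. - For $\gamma\ge1$: $\tilde R_{m,0,\gamma}=\tilde S_{m,1,\gamma-1}=\langle\tilde R_{m,1,\gamma-1},\ I_{m2^{\gamma-1}}\otimes g_1\begin{pmatrix}0&1\\ -1&0\end{pmatrix}g_1^{-1}\rangle\le\mathrm{GL}_{m2^\gamma}(\eta q)$. - For $\gamma\ge1$: $\tilde R^+_{m,0,\gamma}=\langle I_m\otimes x_j,I_m\otimes y_j:1\le j\le\gamma\rangle$, and $\tilde R^-_{m,0,\gamma}=\langle I_m\otimes x_j,\ I_m\otimes y_j\ (1\le j\le\gamma-1),\ I_{m2^{\gamma-1}}\otimes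 g_1\mathrm{diag}(\zeta_4,\zeta_4^{-1})g_1^{-1},\ I_{m2^{\gamma-1}}\otimes g_1\begin{pmatrix}0&1\\ -1&0\end{pmatrix}g_1^{-1}\rangle$, $\zeta_4$ of order 4, both in $\mathrm{GL}_{m2^\gamma}(\eta q)$. - $\tilde R_{m,0,0}=\{\pm I_m\}\le\mathrm{GL}_m(\eta q)$. For a finite sequence $\mathbf c=(c_1,\dots,c_r)$ of positive integers (the empty sequence is $\mathbf 0$), $|\mathbf c|=c_1+\cdots+c_r$, $A_{\mathbf c}=A_{c_1}\wr\cdots\wr A_{c_r}\le\mathfrak S_{2^{|\mathbf c|}}$, where $A_c$ is elementary abelian of order $2^c$ in its regular permutation representation; $\tilde R_{m,\alpha,\gamma,\mathbf c}=\tilde R_{m,\alpha,\gamma}\wr A_{\mathbf c}$ and $\tilde R^\pm_{m,0,\gamma,\mathbf c}=\tilde R^\pm_{m,0,\gamma}\wr A_{\mathbf c}$. A $2$-subgroup $\tilde R$ of a finite group $\tilde H$ is radical if $\tilde R=\mathrm O_2(N_{\tilde H}(\tilde R))$. If $H\unlhd\tilde H$, a radical $2$-subgroup $\tilde R$ of $\tilde H$ is special with respect to $H$ if $\tilde R=\mathrm O_2(N_{\tilde H}(\tilde R\cap H))$. *)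

(* Defs.v *)
From mathcomp Require Import all_boot all_order all_fingroup all_algebra all_solvable.
From mathcomp Require Import mxtens.
From mathcomp Require Import boolp.

Set Implicit Arguments.
Unset Strict Implicit.
Unset Printing Implicit Defensive.

Import GRing.Theory.
Local Open Scope ring_scope.

Section RadicalSpecial.
Variables (gT : finGroupType).
Implicit Types Ht H R : {set gT}.

Definition radical2 Ht R : Prop :=
  [/\ group_set R, R \subset Ht, (2.-group R)%g & R = ('O_2('N_Ht(R)))%g].

Definition special2 Ht H R : Prop :=
  radical2 Ht R /\ R = ('O_2('N_Ht(R :&: H)))%g.

End RadicalSpecial.

Section PermutationGroups.

(* The regular representation, on the 2 ^ c points of the group itself. *)
Definition regular_elem_abelian (c : nat) : {set {perm 'rV['F_2]_c}} :=
  [set s : {perm 'rV['F_2]_c} | [exists v, [forall u, s u == u + v]]].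

(* G is the base (block) group, H permutes the blocks S * {t}. *)
Definition wreath_perm (S T : finType) (G : {set {perm S}})
    (H : {set {perm T}}) : {set {perm (S * T)%type}} :=
  [set s : {perm (S * T)%type} |
    [exists h in H, exists g : {ffun T -> {perm S}},
      [forall t, g t \in G] && [forall x, s x == (g x.2 x.1, h x.2)]]].

(* The 2 ^ |c| points on which A_c = A_c1 wr (A_c2 wr ...) acts; c1 is the
   innermost factor. *)
Fixpoint points (c : seq nat) : finType :=
  if c is c1 :: c' then ('rV['F_2]_c1 * points c')%type else unit.

Fixpoint Aseq (c : seq nat) : {set {perm points c}} :=
  match c return {set {perm points c}} with
  | [::] => [set 1%g]
  | c1 :: c' => wreath_perm (regular_elem_abelian c1) (Aseq c')
  end.

Definition permutation_mx (K : fieldType) (T : finType) (s : {perm T}) :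
    'M[K]_#|T| :=
  \matrix_(i, j) (s (enum_val i) == enum_val j)%:R.

End PermutationGroups.

Section Matrices.
Variable K : fieldType.

(* The tensor product with the convention (b_ij A); tensmx is (a_ij B), whence
   the swap.  The size N of the result is read off the context, so that e.g.
   2 ^ g.+1 and m * 2 ^ (a + g) can be used as sizes: conform_mx is the
   identity cast when n2 * n1 = N (and 0 otherwise), and tens is only used
   with n2 * n1 = N. *)
Definition tens {n1 n2 N} (A : 'M[K]_n1) (B : 'M[K]_n2) : 'M[K]_N :=
  conform_mx 0 (tensmx B A).

(* diag(A_0, ..., A_(d-1)), used with d * n = N. *)
Definition blockdiag {n d N} (A : 'I_d -> 'M[K]_n) : 'M[K]_N :=
  \sum_(i < d) tens (A i) (delta_mx i i : 'M[K]_d).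

Definition mx22 (a b c d : K) : 'M[K]_2 :=
  (block_mx a%:M b%:M c%:M d%:M : 'M[K]_(1 + 1)).

Definition xmx : 'M[K]_2 := mx22 1 0 0 (-1).
Definition ymx : 'M[K]_2 := mx22 0 1 1 0.
Definition wmx : 'M[K]_2 := mx22 0 1 (-1) 0.

(* The g-fold tensor product with A in position j (1 <= j <= g) and the
   identity matrix in the other positions. *)
Fixpoint tens_at (A : 'M[K]_2) (j g : nat) : 'M[K]_(2 ^ g) :=
  if g is g'.+1 then tens (tens_at A j g') (if j == g then A else 1%:M : 'M[K]_2)
  else 1%:M.

(* The matrix (0, -1; I_(k-1), 0). *)
Definition cycle_mx (k : nat) : 'M[K]_k :=
  \matrix_(i, j) ((val i == j.+1)%N%:R -
                  ((val i == 0) && (val j == k.-1))%N%:R).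

(* The subgroup generated by a set of invertible matrices. *)
Inductive generated n (S : 'M[K]_n -> Prop) : 'M[K]_n -> Prop :=
| generated_1 : generated S 1%:M
| generated_M A B : S A -> generated S B -> generated S (A *m B)
| generated_V A B : S A -> generated S B -> generated S (invmx A *m B).

(* Block monomial matrices: nonzero blocks in R, block pattern in P; used with
   #|T| * n = N. *)
Definition wreath_mx n N (T : finType) (R : 'M[K]_n -> Prop)
    (P : {set {perm T}}) (M : 'M[K]_N) : Prop :=
  exists A : 'I_#|T| -> 'M[K]_n, exists s : {perm T},
    [/\ forall i, R (A i), s \in P &
        M = blockdiag A *m tens (1%:M : 'M[K]_n) (permutation_mx K s)].

Variables (q : nat) (eta : int).

Definition Fmx n (A : 'M[K]_n) : 'M[K]_n :=
  let Aq := map_mx (fun x => x ^+ q) A in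
  if eta == 1 then Aq else (invmx Aq)^T.

(* GL_n(eta q) and SL_n(eta q) inside GL_n(K), K algebraically closed. *)
Definition isGL n (A : 'M[K]_n) : Prop := A \in unitmx /\ Fmx A = A.
Definition isSL n (A : 'M[K]_n) : Prop := isGL A /\ \det A = 1.

(* Realization of a set of matrices over K with entries in the image of a
   finite subfield L as a set of elements of the finite group GL_n(L).  The
   matrix of u : {'GL_n[L]} has size n.-1.+1; conform_mx only casts it to
   size n (for n > 0). *)
Definition inGL (L : finFieldType) (iota : L -> K) n (P : 'M[K]_n -> Prop) :
    {set {'GL_n[L]}} :=
  [set u : {'GL_n[L]} | `[< P (conform_mx 0 (map_mx iota (GLval u))) >]].

(* Used for zeta al of order 2 ^ (a + al), zeta4 of order 4, and g al of
   determinant 1 with invmx (g al) *m Fmx (g al) = cycle_mx (2 ^ al), al > 0. *)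
Variables (zeta : nat -> K) (zeta4 : K) (g : forall al : nat, 'M[K]_(2 ^ al)).

Definition conj1 (A : 'M[K]_2) : 'M[K]_2 := (g 1 : 'M[K]_2) *m A *m invmx (g 1).

(* The matrices I_m (x) x_j and I_m (x) y_j for 1 <= j <= r, where x_j and y_j
   are ga-fold tensor products. *)
Definition xy_gens (m ga r : nat) (M : 'M[K]_(m * 2 ^ ga)) : Prop :=
  exists2 j, (1 <= j <= r)%N &
    M = tens (1%:M : 'M[K]_m) (tens_at xmx j ga) \/
    M = tens (1%:M : 'M[K]_m) (tens_at ymx j ga).

Definition Rzero (m al ga : nat) : 'M[K]_(m * 2 ^ ga) -> Prop :=
  generated (fun M => M = (zeta al)%:M \/ @xy_gens m ga ga M).

(* The group R_(m,al,ga) for al > 0. *)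
Definition Rpos (m al ga : nat) (M : 'M[K]_(m * 2 ^ (al + ga))) : Prop :=
  exists2 A, @Rzero m al ga A &
    let gg : 'M[K]_(m * 2 ^ (al + ga)) :=
      tens (1%:M : 'M[K]_(m * 2 ^ ga)) (g al) in
    M = gg *m blockdiag (fun i : 'I_(2 ^ al) => iter i (@Fmx (m * 2 ^ ga)) A)
           *m invmx gg.

(* The group S_(m,1,ga) = R_(m,0,ga+1). *)
Definition Sone (m ga : nat) : 'M[K]_(m * 2 ^ ga.+1) -> Prop :=
  generated (fun M => @Rpos m 1 ga M \/
                      M = tens (1%:M : 'M[K]_(m * 2 ^ ga)) (conj1 wmx)).

Definition Rbase (m al ga : nat) : 'M[K]_(m * 2 ^ (al + ga)) -> Prop :=
  match al, ga return 'M[K]_(m * 2 ^ (al + ga)) -> Prop with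
  | 0, 0 => fun M => M = 1%:M \/ M = - 1%:M
  | 0, ga'.+1 => @Sone m ga'
  | al'.+1, _ => @Rpos m al'.+1 ga
  end.

Definition Rplus (m ga : nat) : 'M[K]_(m * 2 ^ ga) -> Prop :=
  generated (@xy_gens m ga ga).

(* Meant for ga > 0. *)
Definition Rminus (m ga : nat) : 'M[K]_(m * 2 ^ ga) -> Prop :=
  generated (fun M =>
    [\/ @xy_gens m ga ga.-1 M,
        M = tens (1%:M : 'M[K]_(m * 2 ^ ga.-1))
                 (conj1 (mx22 zeta4 0 0 zeta4^-1)) |
        M = tens (1%:M : 'M[K]_(m * 2 ^ ga.-1)) (conj1 wmx)]).

End Matrices.

(* The types (al, ga) of R_(m,al,ga), and (+, ga), (-, ga) of R^+_(m,0,ga) and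
   R^-_(m,0,ga). *)
Inductive basic_type := Unsigned of nat & nat | Plus of nat | Minus of nat.

Definition two_exponent (t : basic_type) : nat :=
  match t with Unsigned al ga => al + ga | Plus ga => ga | Minus ga => ga end.

Definition admissible (t : basic_type) (c : seq nat) : Prop :=
  match t with
  | Unsigned al ga => ~ [/\ al = 0, ga = 0 & head 0 c = 1]%N
  | Plus ga => (1 < ga)%N
  | Minus ga => (0 < ga)%N
  end.

Section Basic.
Variables (K : fieldType) (q : nat) (eta : int).
Variables (zeta : nat -> K) (zeta4 : K) (g : forall al : nat, 'M[K]_(2 ^ al)).

Definition basic0 (m : nat) (t : basic_type) :
    'M[K]_(m * 2 ^ two_exponent t) -> Prop :=
  match t return 'M[K]_(m * 2 ^ two_exponent t) -> Prop with
  | Unsigned al ga => @Rbase K q eta zeta g m al ga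
  | Plus ga => @Rplus K m ga
  | Minus ga => @Rminus K zeta4 g m ga
  end.

Definition basic (m : nat) (t : basic_type) (c : seq nat) :
    'M[K]_(m * 2 ^ (two_exponent t + sumn c)) -> Prop :=
  wreath_mx (@basic0 m t) (Aseq c).

End Basic.

Arguments Fmx {K} q eta {n} A.
Arguments isGL {K} q eta {n} A.
Arguments isSL {K} q eta {n} A.
Arguments inGL {K L} iota {n} P.
Arguments basic {K} q eta zeta zeta4 g m t c _.
Arguments cycle_mx {K} k.

(* Main.v *)
Require Import Defs.
From HB Require Import structures.
From mathcomp Require Import all_boot all_order all_fingroup all_algebra all_solvable.
From mathcomp Require Import mxtens finfield boolp.
From mathcomp Require Import zify.

Set Implicit Arguments.
Unset Strict Implicit.
Unset Printing Implicit Defensive.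

Import GRing.Theory.
Local Open Scope ring_scope.

(** Let R be the basic subgroup, S its part of determinant 1, and let x in
GL_N(eta q) normalize S.  It suffices that x normalizes R: then R and S have
the same normalizer in GL_N(eta q), and R, being radical, is its 2-core.

As q - eta is 2 modulo 4, the determinants of the elements of R are 1 or -1.
If all of them are 1, then R = S.  Computing the determinants of generators
shows that this is so outside three families R = D wr A_c, where D is cyclic
(alpha > 0, gamma = 0), semidihedral (alpha = 0, gamma = 1) or {1, -1}
(alpha = gamma = 0).  In these families let C be D or, if D is semidihedral, its
cyclic maximal subgroup, and let B consist of the block diagonal matrices of
determinant 1 with blocks in C.  Then B is abelian and normal in S, hence so is
its conjugate F under x.  The heart of the proof is that F = B.

If C has order at least 8 ([base_conj_sub_base]), suppose that f in F moves the
block i, and let u in S be the square of a generator of C on the block i and 1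
on the others.  The commutator of f and u lies in F, hence commutes with f, and
comparing blocks gives u ^ 2 = 1, which is false.  So F is block diagonal.  It
has elements with a block of order at least 8, by transitivity of A_c at any
given place; such a block lies in C and is centralized in D by C alone.

If C = {1, -1}, the same commutators only show that two elements of F moving a
block move it to the same place ([base_conj_move]).  Since c_1 > 1, conjugating by
translations in the innermost factor A_(c_1) shows that the elements of F act as
translations on each of the 2 ^ (|c| - c_1) orbits of its base group, and that
all the nontrivial ones agree there.  If there is one, then an element of F is
determined by the orbits that it moves and by half of its signs, so F has
at most 2 ^ (N / 4 + N / 2) elements where N = 2 ^ |c| is the number of blocks
([base_conj_perm1]).  But B has order 2 ^ (N - 1), which is larger if N > 4; and
N = 4 only for c = (2).

Once x normalizes B, it permutes the projections onto the blocks, because they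
are linear combinations of elements of B.  Therefore it sends a matrix that is
an element of C on one block and 1 on the others to a matrix of the same form.
Such a matrix of determinant -1 generates R together with S
([block_wreath_conj]). *)

(** * Determinants of tensor products and of block diagonal matrices *)
Section Blocks.
Variable K : fieldType.

Definition block_of n d (M : 'M[K]_(d * n)) (i j : 'I_d) : 'M[K]_n :=
  \matrix_(a, b) M (mxtens_index (i, a)) (mxtens_index (j, b)).

Lemma block_ofP n d (M M' : 'M[K]_(d * n)) :
  (forall i j, block_of M i j = block_of M' i j) -> M = M'.
Proof.
move=> eqM; apply/matrixP=> x y.
case: (mxtens_indexP x) => i a; case: (mxtens_indexP y) => j b.
by have /matrixP/(_ a b) := eqM i j; rewrite !mxE.
Qed.

Lemma block_ofM n d (M M' : 'M[K]_(d * n)) i j :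
  block_of (M *m M') i j = \sum_k block_of M i k *m block_of M' k j.
Proof.
apply/matrixP=> a b; rewrite summxE !mxE.
rewrite (reindex (@mxtens_index d n)) /=; last first.
  by exists (@mxtens_unindex d n) => x _; rewrite (mxtens_indexK, mxtens_unindexK).
transitivity (\sum_(k < d) \sum_(l < n)
  M (mxtens_index (i, a)) (mxtens_index (k, l)) *
  M' (mxtens_index (k, l)) (mxtens_index (j, b))).
  by rewrite pair_bigA; apply: eq_bigr => -[].
by apply: eq_bigr => k _; rewrite !mxE; apply: eq_bigr => l _; rewrite !mxE.
Qed.

Lemma block_of_scalar n d (z : K) i j :
  block_of (z%:M : 'M_(d * n)) i j = if i == j then z%:M else 0.
Proof.
apply/matrixP=> a b; rewrite !mxE (inj_eq (can_inj (@mxtens_indexK d n))) xpair_eqE.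
by case: eqP; rewrite mxE.
Qed.

Lemma block_of_tensmx n d (A : 'M[K]_d) (B : 'M[K]_n) i j :
  block_of (tensmx A B) i j = A i j *: B.
Proof. by apply/matrixP=> a b; rewrite mxE tensmxE [RHS]mxE. Qed.

Lemma block_of_blockdiag n d (A : 'I_d -> 'M[K]_n) i j :
  block_of (blockdiag A) i j = if i == j then A i else 0.
Proof.
transitivity (\sum_k block_of (tens (A k) (delta_mx k k : 'M_d) : 'M_(d * n)) i j).
  by apply/matrixP=> a b; rewrite mxE !summxE; apply: eq_bigr => k _; rewrite [RHS]mxE.
have blkT k : block_of (tens (A k) (delta_mx k k : 'M_d) : 'M_(d * n)) i j
    = ((i == k) && (j == k))%:R *: A k.
  by rewrite /tens conform_mx_id block_of_tensmx !mxE.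
rewrite (eq_bigr _ (fun k _ => blkT k)) (bigD1 i) //= big1 ?addr0 => [|k /negPf].
  by rewrite eqxx (eq_sym j); case: eqP; rewrite /= ?scale1r ?scale0r.
by rewrite eq_sym => ->; rewrite scale0r.
Qed.

Lemma det_reindex N N' (f : 'I_N -> 'I_N') (A : 'M[K]_N') :
  bijective f -> \det (\matrix_(i, j) A (f i) (f j)) = \det A.
Proof.
move=> bij_f; have eN: N = N' by rewrite -(card_ord N) (bij_eq_card bij_f) card_ord.
subst N'; have inj_f := bij_inj bij_f.
have ->: (\matrix_(i, j) A (f i) (f j))
    = row_perm (perm inj_f) (col_perm (perm inj_f) A).
  by apply/matrixP=> i j; rewrite !mxE !permE.
by rewrite row_permE col_permE !det_mulmx !det_perm odd_permV mulrC -mulrA -expr2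
   sqrr_sign mulr1.
Qed.

(** Induction on the number of blocks: the index set of d.+1 blocks of size n is
by computation n + d * n, so that block_mx applies. *)
Lemma det_blockdiag_tens n d (A : 'I_d -> 'M[K]_n) :
  \det (blockdiag A : 'M_(d * n)) = \prod_i \det (A i).
Proof.
elim: d A => [|d IHd] A; first by rewrite big_ord0 det_mx00.
rewrite big_ord_recl -IHd.
pose B := blockdiag (fun i => A (lift ord0 i)) : 'M_(d * n).
rewrite -[X in _ * X]/(\det B) -(det_ublock (A ord0) 0 B).
congr (\det _); apply: (@block_ofP n d.+1) => i j.
rewrite block_of_blockdiag; apply/matrixP=> a b; rewrite [RHS]mxE.
have idx0 (x : 'I_n) : mxtens_index (ord0 : 'I_d.+1, x) = lshift (d * n) x.
  exact/val_inj.
have idxS k (x : 'I_n) : mxtens_index (lift ord0 k : 'I_d.+1, x)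
    = rshift n (mxtens_index (k, x)).
  by apply/val_inj; rewrite /= mulSn addnA.
case: (unliftP ord0 i) => [i'|] ->; case: (unliftP ord0 j) => [j'|] ->.
- rewrite !idxS block_mxEdr (inj_eq (@lift_inj _ ord0)).
  by have /matrixP/(_ a b) := block_of_blockdiag (fun i => A (lift ord0 i)) i' j';
    rewrite !mxE.
- by rewrite idxS idx0 block_mxEdl !mxE.
- by rewrite idxS idx0 block_mxEur !mxE.
- by rewrite !idx0 block_mxEul eqxx.
Qed.

(** The tensor product is the product of 1 (x) B, which is block diagonal, and
A (x) 1, which becomes block diagonal when the two factors of the index set are
exchanged. *)
Lemma det_tensmx n d (A : 'M[K]_d) (B : 'M[K]_n) :
  \det (tensmx A B) = \det A ^+ n * \det B ^+ d.
Proof.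
have det1t p r (C : 'M[K]_p) : \det (tensmx (1%:M : 'M_r) C) = \det C ^+ r.
  have <-: (blockdiag (fun _ : 'I_r => C) : 'M_(r * p)) = tensmx (1%:M : 'M_r) C.
    apply: block_ofP => i j; rewrite block_of_blockdiag block_of_tensmx mxE.
    by case: eqP; rewrite ?scale1r ?scale0r.
  by rewrite det_blockdiag_tens prodr_const card_ord.
rewrite tensmx_decl det_mulmx det1t mulrC; congr (_ * _).
rewrite -(det1t d n).
pose f (x : 'I_(d * n)) : 'I_(n * d) :=
  let y := mxtens_unindex x in mxtens_index (y.2, y.1).
pose f' (x : 'I_(n * d)) : 'I_(d * n) :=
  let y := mxtens_unindex x in mxtens_index (y.2, y.1).
have bij_f : bijective f.
  by exists f' => x; case: (mxtens_indexP x) => i a; rewrite /f /f' !mxtens_indexK.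
rewrite -(det_reindex _ bij_f); congr (\det _); apply/matrixP=> x y.
case: (mxtens_indexP x) => i a; case: (mxtens_indexP y) => j b.
by rewrite [RHS]mxE /f !mxtens_indexK !tensmxE mulrC.
Qed.

(** The same facts for matrices whose size N is only provably the product of the
two sizes. *)
Section Tens.
Variables (n1 n2 N : nat) (eN : (n2 * n1)%N = N).

Lemma tensM (A A' : 'M[K]_n1) (B B' : 'M[K]_n2) :
  tens A B *m tens A' B' = tens (A *m A') (B *m B') :> 'M_N.
Proof. by case: N / eN; rewrite /tens !conform_mx_id tensmx_mul. Qed.

Lemma tens_scalar (z : K) : tens (1%:M : 'M_n1) (z%:M : 'M_n2) = z%:M :> 'M_N.
Proof.
case: N / eN; rewrite /tens conform_mx_id; apply: block_ofP => i j.
rewrite block_of_tensmx block_of_scalar mxE; case: eqP => _; last by rewrite scale0r.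
by rewrite scale_scalar_mx mulr1.
Qed.

Lemma tens11 : tens (1%:M : 'M[K]_n1) (1%:M : 'M_n2) = 1%:M :> 'M_N.
Proof. exact: tens_scalar. Qed.

Lemma det_tens (A : 'M[K]_n1) (B : 'M[K]_n2) :
  \det (tens A B : 'M_N) = \det A ^+ n2 * \det B ^+ n1.
Proof. by case: N / eN; rewrite /tens conform_mx_id det_tensmx mulrC. Qed.

Lemma tr_tens (A : 'M[K]_n1) (B : 'M[K]_n2) :
  (tens A B)^T = tens A^T B^T :> 'M_N.
Proof. by case: N / eN; rewrite /tens !conform_mx_id trmx_tens. Qed.

Lemma map_tens (h : {rmorphism K -> K}) (A : 'M[K]_n1) (B : 'M[K]_n2) :
  map_mx h (tens A B) = tens (map_mx h A) (map_mx h B) :> 'M_N.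
Proof. by case: N / eN; rewrite /tens !conform_mx_id map_mxT. Qed.

Lemma tens_unit (A : 'M[K]_n1) (B : 'M[K]_n2) :
  A \in unitmx -> B \in unitmx -> (tens A B : 'M_N) \in unitmx.
Proof. by rewrite !unitmxE det_tens => uA uB; rewrite unitrM !unitrX. Qed.

Lemma tens_inv (B : 'M[K]_n2) : B \in unitmx ->
  invmx (tens (1%:M : 'M_n1) B : 'M_N) = tens (1%:M : 'M_n1) (invmx B).
Proof.
move=> uB; have uT : (tens (1%:M : 'M_n1) B : 'M_N) \in unitmx by apply: tens_unit;
  rewrite ?unitmx1.
apply: (can_inj (mulKmx uT)); rewrite mulmxV // tensM mulmx1 mulmxV //.
by rewrite tens11.
Qed.

End Tens.

Section Blockdiag.
Variables (n d N : nat) (eN : (d * n)%N = N).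

Lemma eq_blockdiag (A B : 'I_d -> 'M[K]_n) :
  A =1 B -> blockdiag A = blockdiag B :> 'M_N.
Proof. by move=> eqAB; apply: eq_bigr => i _; rewrite eqAB. Qed.

Lemma det_blockdiag (A : 'I_d -> 'M[K]_n) :
  \det (blockdiag A : 'M_N) = \prod_i \det (A i).
Proof. by case: N / eN; apply: det_blockdiag_tens. Qed.

Lemma blockdiag_scalar (z : 'I_d -> K) :
  blockdiag (fun i => (z i)%:M : 'M_n)
    = tens (1%:M : 'M_n) (diag_mx (\row_i z i)) :> 'M_N.
Proof.
case: N / eN; apply: block_ofP => i j; rewrite block_of_blockdiag.
rewrite /tens conform_mx_id block_of_tensmx !mxE.
by case: eqP => _; rewrite ?scale0r ?mulr1n // scale_scalar_mx mulr1.
Qed.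

End Blockdiag.
End Blocks.

(** * Block monomial matrices *)
(** The nonzero block of row i is A i, in column s i; hence the product of two such
matrices composes the permutations from left to right.  The definition is locked
because it is headed by a matrix product, which rewriting would unfold. *)
HB.lock Definition monomial_mx (K : fieldType) (T : finType) (n : nat) (A : T -> 'M[K]_n)
    (s : {perm T}) : 'M[K]_(#|T| * n) :=
  blockdiag (fun i : 'I_#|T| => A (enum_val i)) *m tens (1%:M : 'M_n) (permutation_mx K s).

Section Monomial.
Variables (K : fieldType) (T : finType) (n : nat).
Implicit Types (A B : T -> 'M[K]_n) (s t : {perm T}).

Local Notation monomial_mx := (@monomial_mx K T n).

Definition diag_blocks A := monomial_mx A 1%g.

Definition block_at (M : 'M[K]_(#|T| * n)) (i j : T) := block_of M (enum_rank i) (enum_rank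
  j).

Lemma block_atP M M' : (forall i j, block_at M i j = block_at M' i j) -> M = M'.
Proof.
move=> eqM; apply: block_ofP => i j.
by have := eqM (enum_val i) (enum_val j); rewrite /block_at !enum_valK.
Qed.

Lemma block_at_monomial A s i j : block_at (monomial_mx A s) i j
  = if s i == j then A i else 0.
Proof.
rewrite monomial_mx.unlock /block_at block_ofM (bigD1 (enum_rank i)) //= big1 => [|k neq];
  last first.
  by rewrite block_of_blockdiag eq_sym (negPf neq) mul0mx.
rewrite block_of_blockdiag eqxx addr0 enum_rankK /tens conform_mx_id block_of_tensmx mxE.
by rewrite !enum_rankK; case: eqP => _; rewrite ?scale1r ?mulmx1 ?scale0r ?mulmx0.
Qed.

Lemma block_atM M M' i j : block_at (M *m M') i j
  = \sum_k block_at M i k *m block_at M' k j.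
Proof.
rewrite /block_at block_ofM (reindex (@enum_rank T)) //=.
by apply: onW_bij; apply: enum_rank_bij.
Qed.

Lemma block_atD M M' i j : block_at (M + M') i j = block_at M i j + block_at M' i j.
Proof. by apply/matrixP=> a b; rewrite !mxE. Qed.

Lemma block_atN M i j : block_at (- M) i j = - block_at M i j.
Proof. by apply/matrixP=> a b; rewrite !mxE. Qed.

Lemma monomialM A s B t :
  monomial_mx A s *m monomial_mx B t = monomial_mx (fun i => A i *m B (s i)) (s * t)%g.
Proof.
apply: block_atP => i j; rewrite block_atM block_at_monomial permM (bigD1 (s i)) //= big1.
  by rewrite !block_at_monomial eqxx addr0; case: eqP => _; rewrite ?mulmx0.
by move=> k /negPf neq; rewrite block_at_monomial eq_sym neq mul0mx.
Qed.

Lemma eq_monomial A B s : A =1 B -> monomial_mx A s = monomial_mx B s.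
Proof. by move=> eqAB; apply: block_atP => i j; rewrite !block_at_monomial eqAB. Qed.

Lemma monomial_inj A s B t : (forall i, A i != 0) ->
  monomial_mx A s = monomial_mx B t -> s = t /\ A =1 B.
Proof.
move=> nzA eqM; have blkE i : A i = if t i == s i then B i else 0.
  by rewrite -block_at_monomial -eqM block_at_monomial eqxx.
have eqst : s = t.
  apply/permP=> i; apply/esym/eqP; apply: contraT => /negPf neq.
  by move: (nzA i); rewrite blkE neq eqxx.
by split=> // i; rewrite blkE eqst eqxx.
Qed.

Lemma diag_blocksM A B : diag_blocks A *m diag_blocks B = diag_blocks (fun i => A i *m B i).
Proof. by rewrite /diag_blocks monomialM mulg1; apply: eq_monomial => i; rewrite perm1. Qed.

Lemma diag_monomial A B s : diag_blocks A *m monomial_mx B s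
  = monomial_mx (fun i => A i *m B i) s.
Proof. by rewrite /diag_blocks monomialM mul1g; apply: eq_monomial => i; rewrite perm1. Qed.

Lemma monomial_diag A B s : monomial_mx A s *m diag_blocks B
  = monomial_mx (fun i => A i *m B (s i)) s.
Proof. by rewrite /diag_blocks monomialM mulg1. Qed.

Lemma eq_diag_blocks A B : A =1 B -> diag_blocks A = diag_blocks B.
Proof. exact: eq_monomial. Qed.

Lemma diag_blocks_inj A B : diag_blocks A = diag_blocks B -> A =1 B.
Proof.
move=> eqM i; have := congr1 (fun M => block_at M i i) eqM.
by rewrite /diag_blocks !block_at_monomial perm1 eqxx.
Qed.

Lemma diag_blocksD A B : diag_blocks A + diag_blocks B = diag_blocks (fun i => A i + B i).
Proof.
apply: block_atP => i j; rewrite block_atD !block_at_monomial perm1.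
by case: eqP => // _; rewrite addr0.
Qed.

Lemma diag_blocksN A : - diag_blocks A = diag_blocks (fun i => - A i).
Proof.
apply: block_atP => i j; rewrite block_atN !block_at_monomial perm1.
by case: eqP => // _; rewrite oppr0.
Qed.

Lemma diag_blocks1 : diag_blocks (fun _ => 1%:M) = 1%:M.
Proof.
apply: block_atP => i j; rewrite block_at_monomial perm1 /block_at block_of_scalar.
by rewrite (inj_eq enum_rank_inj).
Qed.

Lemma permutation_mx_sqr_det s : \det (permutation_mx K s) ^+ 2 = 1.
Proof.
suff: permutation_mx K s *m (permutation_mx K s)^T = 1%:M.
  by move/(congr1 (fun M => \det M)); rewrite det_mulmx det_tr det1 expr2.
apply/matrixP=> i j; rewrite !mxE (bigD1 (enum_rank (s (enum_val i)))) //= big1.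
  rewrite !mxE !enum_rankK eqxx mul1r addr0 (inj_eq perm_inj) (inj_eq enum_val_inj).
  by rewrite eq_sym.
move=> k neq; rewrite !mxE; case: eqP => [eq_k|]; rewrite ?mul0r //.
by case/eqP: neq; rewrite eq_k enum_valK.
Qed.

Lemma det_diag_blocks A : \det (diag_blocks A) = \prod_i \det (A i).
Proof.
rewrite /diag_blocks monomial_mx.unlock det_mulmx det_blockdiag // (reindex (@enum_rank T))
  /=; last first.
  by apply: onW_bij; apply: enum_rank_bij.
have ->: permutation_mx K (1%g : {perm T}) = 1%:M.
  by apply/matrixP=> i j; rewrite !mxE perm1 (inj_eq enum_val_inj).
by rewrite tens11 // det1 mulr1; apply: eq_bigr => i _; rewrite enum_rankK.
Qed.

Lemma det_monomial A s :
  \det (monomial_mx A s) = \prod_i \det (A i) * \det (permutation_mx K s) ^+ n.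
Proof.
rewrite -det_diag_blocks.
have ->: monomial_mx A s = diag_blocks A *m monomial_mx (fun _ => 1%:M) s.
  by rewrite diag_monomial; apply: eq_monomial => i; rewrite mulmx1.
rewrite det_mulmx [in X in _ * X]monomial_mx.unlock [X in _ * X]det_mulmx det_blockdiag //.
by rewrite big1 ?mul1r ?det_tens ?det1 ?expr1n ?mul1r // => i _; rewrite det1.
Qed.

Lemma det_monomial_even A s : ~~ odd n -> \det (monomial_mx A s) = \prod_i \det (A i).
Proof.
move=> n_even; rewrite det_monomial.
suff ->: \det (permutation_mx K s) ^+ n = 1 by rewrite mulr1.
rewrite -[n]odd_double_half (negPf n_even) -mul2n exprM.
by rewrite permutation_mx_sqr_det expr1n.
Qed.

(** A permutation matrix has determinant 1 or -1, whatever its size. *)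
Lemma det_monomial_sign A s : (forall i, \det (A i) ^+ 2 = 1) ->
  \det (monomial_mx A s) = 1 \/ \det (monomial_mx A s) = -1.
Proof.
move=> dA; have : \det (monomial_mx A s) ^+ 2 == 1 ^+ 2.
  rewrite det_monomial exprMn -prodrXl big1 ?mul1r ?expr1n => [|i _]; last exact: dA.
  by rewrite exprAC permutation_mx_sqr_det expr1n.
by rewrite eqf_sqr => /orP[] /eqP->; [left | right].
Qed.

Lemma tr_monomial A s :
  (monomial_mx A s)^T = monomial_mx (fun i => (A ((s^-1)%g i))^T) (s^-1)%g.
Proof.
apply: block_atP => i j.
transitivity ((block_at (monomial_mx A s) j i)^T); first by apply/matrixP=> a b;
  rewrite !mxE.
rewrite !block_at_monomial -[(s^-1)%g i == j](inj_eq (@perm_inj _ s)) permKV eq_sym.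
by case: eqP => [->|]; rewrite ?permK ?trmx0.
Qed.

Lemma map_monomial (h : {rmorphism K -> K}) A s :
  map_mx h (monomial_mx A s) = monomial_mx (fun i => map_mx h (A i)) s.
Proof.
apply: block_atP => i j.
transitivity (map_mx h (block_at (monomial_mx A s) i j)); first by apply/matrixP=> a b;
  rewrite !mxE.
by rewrite !block_at_monomial; case: eqP => //; rewrite map_mx0.
Qed.

Definition single_block (i : T) (c : 'M[K]_n) : T -> 'M_n :=
  fun k => if k == i then c else 1%:M.

Local Notation single_mx i c := (diag_blocks (single_block i c)).

Lemma det_single_block i c : \det (single_mx i c) = \det c.
Proof.
rewrite det_diag_blocks (bigD1 i) //= big1 => [|k /negPf neq];
  rewrite /single_block ?eqxx ?mulr1 //.
by rewrite neq det1.
Qed.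

Lemma single_blockM i c c' : single_mx i c *m single_mx i c' = single_mx i (c *m c').
Proof.
by rewrite diag_blocksM; apply: eq_diag_blocks => k; rewrite /single_block; case: eqP;
  rewrite ?mulmx1.
Qed.

Lemma single_block1 i : diag_blocks (single_block i 1%:M) = 1%:M.
Proof.
by rewrite -diag_blocks1; apply: eq_diag_blocks => k; rewrite /single_block; case: eqP.
Qed.

End Monomial.

(** * Matrices that normalize the determinant-one part of a wreath product *)
Section Wreath.
Variables (K : fieldType) (T : finType) (n : nat).
Variables (D C : 'M[K]_n -> Prop) (P : {set {perm T}}).

Definition block_wreath (M : 'M[K]_(#|T| * n)) : Prop :=
  exists A s, [/\ forall i, D (A i), s \in P & M = monomial_mx A s].

Definition block_wreath1 M := block_wreath M /\ \det M = 1.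

Definition base_det1 (M : 'M[K]_(#|T| * n)) : Prop :=
  exists A, [/\ forall i, C (A i), M = diag_blocks A & \det M = 1].

(** What the proof uses of D wr P: C is an abelian subgroup of D that D normalizes,
and determinants are 1 or -1, both values being taken on C.  Normality is
written without inverses, so that no unit condition occurs. *)
Record wreath_spec (Z : 'M[K]_n) : Prop := WreathSpec {
  ws_two : (2 : K) != 0;
  ws_n : (0 < n)%N;
  ws_unit : forall d, D d -> d \in unitmx;
  ws_mulD : forall d d', D d -> D d' -> D (d *m d');
  ws_sub : forall c, C c -> D c;
  ws_one : C 1%:M;
  ws_mul : forall c c', C c -> C c' -> C (c *m c');
  ws_comm : forall c c', C c -> C c' -> c *m c' = c' *m c;
  ws_inv : forall c, C c -> exists2 c', C c' & c' *m c = 1%:M;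
  ws_norm : forall d c, D d -> C c -> exists2 c', C c' & d *m c = c' *m d;
  ws_P1 : 1%g \in P;
  ws_PM : forall s t, s \in P -> t \in P -> (s * t)%g \in P;
  ws_det : forall M, block_wreath M -> \det M = 1 \/ \det M = -1;
  ws_Z : C Z;
  ws_detZ : \det Z = -1 }.

Local Notation single_mx i c := (diag_blocks (single_block i c)).

Variables (Z : 'M[K]_n) (W : wreath_spec Z).

Variable X : 'M[K]_(#|T| * n).
Hypothesis Xunit : X \in unitmx.
Hypothesis XS : forall M, block_wreath1 M -> block_wreath1 (X *m M *m invmx X).
Hypothesis XS' : forall M, block_wreath1 M -> block_wreath1 (invmx X *m M *m X).

(** This is X B X^-1 for B the group base_det1; the equation M X = X b is easier to
multiply than its solution for M. *)
Definition base_conj M := exists2 b, base_det1 b & M *m X = X *m b.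

Lemma ws_one_neq0 : (1%:M : 'M[K]_n) != 0.
Proof.
have n_gt0 := ws_n W; apply/eqP=> /matrixP/(_ (Ordinal n_gt0) (Ordinal n_gt0)).
by rewrite !mxE eqxx => /eqP; rewrite oner_eq0.
Qed.

Lemma ws_neq0 d : D d -> d != 0.
Proof.
move=> Dd; apply/eqP=> d0; have := ws_unit W Dd.
case/negP: ws_one_neq0; apply/eqP; rewrite -(mulmxV (ws_unit W Dd)).
by rewrite d0 mul0mx.
Qed.

Lemma block_wreathM M M' : block_wreath M -> block_wreath M' -> block_wreath (M *m M').
Proof.
case=> A [s [DA Ps ->]] [B [t [DB Pt ->]]].
rewrite monomialM; exists (fun i => A i *m B (s i)), (s * t)%g; split=> //.
  by move=> i; apply: (ws_mulD W).
exact: (ws_PM W).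
Qed.

Lemma block_wreath_diag A : (forall i, D (A i)) -> block_wreath (diag_blocks A).
Proof. by move=> DA; exists A, 1%g; split=> //; apply: (ws_P1 W). Qed.

Lemma C_single_block (i : T) c : C c -> forall k, C (single_block i c k).
Proof. by move=> Cc k; rewrite /single_block; case: eqP => // _; apply: (ws_one W). Qed.

Lemma D_single_block (i : T) c : C c -> forall k, D (single_block i c k).
Proof. by move=> Cc k; apply/(ws_sub W)/C_single_block. Qed.

Lemma base_det1_block_wreath1 b : base_det1 b -> block_wreath1 b.
Proof.
by case=> A [CA -> db]; split=> //; apply: block_wreath_diag => i; apply: (ws_sub W).
Qed.

Lemma base_det1_comm b b' : base_det1 b -> base_det1 b' -> b *m b' = b' *m b.
Proof.
move=> [A [CA -> _]] [B [CB -> _]]; rewrite !diag_blocksM.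
by apply: eq_diag_blocks => i; apply: (ws_comm W).
Qed.

Lemma base_det1M b b' : base_det1 b -> base_det1 b' -> base_det1 (b *m b').
Proof.
move=> [A [CA -> dA]] [B [CB -> dB]].
exists (fun i => A i *m B i); split; last by rewrite det_mulmx dA dB mulr1.
  by move=> i; apply: (ws_mul W).
by rewrite diag_blocksM.
Qed.

Lemma det1_unit N (M : 'M[K]_N) : \det M = 1 -> M \in unitmx.
Proof. by rewrite unitmxE => ->; rewrite unitr1. Qed.

Lemma base_det1_norm M b : block_wreath1 M -> base_det1 b ->
  exists2 b', base_det1 b' & M *m b = b' *m M.
Proof.
move=> [[A [s [DA Ps eM]]] dM] [B [CB eb db]].
have ex i : exists c', C c' /\ A i *m B (s i) = c' *m A i.
  by have [c' Cc' eq] := ws_norm W (DA i) (CB (s i)); exists c'.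
have [B' B'P] := fin_all_exists ex.
have eqM : M *m b = diag_blocks B' *m M.
  rewrite eM eb monomial_diag diag_monomial; apply: eq_monomial => i.
  by have [_ ->] := B'P i.
exists (diag_blocks B') => //; exists B'; split=> // [i|]; first by have [] := B'P i.
have := congr1 (fun M => \det M) eqM; rewrite !det_mulmx dM db !mulr1.
by move=> <-.
Qed.

Lemma base_conj_block_wreath1 M : base_conj M -> block_wreath1 M.
Proof.
case=> b /base_det1_block_wreath1 Sb eqM.
by rewrite -[M](mulmxK Xunit) eqM; apply: XS.
Qed.

Lemma base_conj_comm M M' : base_conj M -> base_conj M' -> M *m M' = M' *m M.
Proof.
move=> [b Bb eM] [b' Bb' eM']; apply: (can_inj (mulmxK Xunit)).
by rewrite -!mulmxA eM eM' !mulmxA eM eM' -!mulmxA (base_det1_comm Bb Bb').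
Qed.

(** X^-1 s X has determinant 1 and lies in the wreath product, so it normalizes the
base group; conjugating back, s normalizes the conjugate. *)
Lemma base_conj_norm s M : block_wreath1 s -> base_conj M ->
  exists2 M', base_conj M' & s *m M = M' *m s.
Proof.
move=> Ss [b Bb eM]; have Ss' := XS' Ss.
have [b' Bb' eb] := base_det1_norm Ss' Bb.
exists (X *m b' *m invmx X); first by exists b' => //; rewrite mulmxKV.
apply: (can_inj (mulmxK Xunit)); rewrite -[LHS]mulmxA eM.
have -> : s *m (X *m b) = X *m (invmx X *m s *m X *m b).
  by rewrite !mulmxA mulmxV // mul1mx.
by rewrite eb !mulmxA.
Qed.

Lemma base_conjI b : base_det1 b -> base_conj (X *m b *m invmx X).
Proof. by move=> Bb; exists b => //; rewrite mulmxKV. Qed.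

Lemma block_wreath_det_fix (i : T) M : block_wreath M ->
  \det M = 1 \/ \det (single_mx i Z *m M) = 1.
Proof.
move=> /(ws_det W)[|dM]; first by left.
by right; rewrite det_mulmx det_single_block (ws_detZ W) dM mulrNN mulr1.
Qed.

(** A block permutation can have determinant -1; multiplying it by Z in one
block corrects this. *)
Lemma block_wreath1_lift (i0 : T) s : s \in P ->
  exists2 A, (forall i, C (A i)) & block_wreath1 (monomial_mx A s).
Proof.
move=> Ps.
have C1 : forall k : T, C ((fun _ => 1%:M) k) by move=> k; apply: (ws_one W).
have RM : block_wreath (monomial_mx (fun _ => 1%:M) s).
  by exists (fun _ => 1%:M), s; split=> // i; apply: (ws_sub W); apply: (ws_one W).
case: (block_wreath_det_fix i0 RM) => dM; first by exists (fun _ => 1%:M).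
exists (single_block i0 Z); first by apply: C_single_block; apply: (ws_Z W).
have eqM : monomial_mx (single_block i0 Z) s
  = single_mx i0 Z *m monomial_mx (fun _ => 1%:M) s.
  by rewrite diag_monomial; apply: eq_monomial => i; rewrite mulmx1.
rewrite eqM; split=> //; apply: block_wreathM => //.
by apply: block_wreath_diag; apply: D_single_block; apply: (ws_Z W).
Qed.

Lemma det_C c : C c -> T -> \det c * \det c = 1.
Proof.
move=> Cc i; rewrite -(det_single_block i c).
by case: (ws_det W (block_wreath_diag (D_single_block i Cc))) => ->;
  rewrite ?mulr1 // mulrNN mulr1.
Qed.

(** The determinant of c is 1 or -1, so c on two blocks has determinant 1 even when
c on one block does not. *)
Lemma base_det1_pair (i j : T) c : i != j -> C c ->
  base_det1 (single_mx i c *m single_mx j c).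
Proof.
move=> neq Cc; exists (fun k => single_block i c k *m single_block j c k); split.
- by move=> k; apply: (ws_mul W); apply: C_single_block.
- by rewrite diag_blocksM.
- by rewrite det_mulmx !det_single_block det_C.
Qed.

Definition block_proj (i : T) : 'M[K]_(#|T| * n) :=
  diag_blocks (fun k => if k == i then 1%:M else 0).

Lemma single_block_proj i c : single_mx i c
  = diag_blocks (fun k => if k == i then c else 0) + (1%:M - block_proj i).
Proof.
rewrite -diag_blocks1 diag_blocksN !diag_blocksD; apply: eq_diag_blocks => k;
  rewrite /single_block.
by case: eqP; rewrite ?subrr ?addr0 // subr0 add0r.
Qed.

(** If X maps each projection onto a block to the projection onto a set of blocks,
these sets are nonempty and, as products of distinct projections vanish,
disjoint; being as many as the blocks, they are singletons. *)
Lemma block_proj_perm : (forall i, exists Q : {set T}, X *m block_proj i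
  = diag_blocks (fun k => if k \in Q then 1%:M else 0) *m X) ->
  exists f : T -> T, forall i, X *m block_proj i = block_proj (f i) *m X.
Proof.
move=> exQ.
have [Q QE] := fin_all_exists exQ.
have nz i : Q i != set0.
  apply/eqP=> Q0; have := QE i; rewrite Q0.
  rewrite (eq_diag_blocks (B := fun _ => 0)) => [|k]; last by rewrite inE.
  have -> : diag_blocks (fun _ : T => 0 : 'M[K]_n) = 0.
    by apply: block_atP => k l; rewrite block_at_monomial if_same; apply/matrixP=> a b;
      rewrite !mxE.
  rewrite mul0mx => /(congr1 (mulmx (invmx X))); rewrite mulKmx // mulmx0.
  move/(congr1 (fun M => block_at M i i)); rewrite block_at_monomial perm1 !eqxx => /eqP.
  have -> : block_at (0 : 'M[K]_(#|T| * n)) i i = 0 by apply/matrixP=> a b; rewrite !mxE.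
  by rewrite (negPf ws_one_neq0).
have disj i j k : k \in Q i -> k \in Q j -> i = j.
  move=> Qik Qjk; apply/eqP; apply: contraT => neq.
  have p0 : block_proj i *m block_proj j = 0.
    rewrite diag_blocksM -[RHS](subrr (diag_blocks (fun _ =>
      0))) diag_blocksN diag_blocksD; apply: eq_diag_blocks => l.
    by rewrite subr0; case: eqP => [->|]; rewrite ?mul0mx // (negPf neq) mulmx0.
  have := congr1 (mulmx X) p0; rewrite mulmxA QE -mulmxA QE mulmxA mulmx0 diag_blocksM.
  move/(congr1 (fun M => M *m invmx X)); rewrite mulmxK // mul0mx.
  move/(congr1 (fun M => block_at M k k));
    rewrite block_at_monomial perm1 eqxx Qik Qjk mulmx1 => /eqP.
  have -> : block_at (0 : 'M[K]_(#|T| * n)) k k = 0 by apply/matrixP=> a b; rewrite !mxE.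
  by rewrite (negPf ws_one_neq0).
have exf i : exists k, k \in Q i by apply/set0Pn.
have [f fQ] := fin_all_exists exf.
have inj_f : injective f.
  by move=> i j eqf; apply: (disj _ _ (f i)); rewrite // eqf.
exists f => i; rewrite QE; congr (_ *m _); apply: eq_diag_blocks => k.
have [g fK gK] := injF_bij inj_f.
suff -> : (k \in Q i) = (k == f i) by [].
apply/idP/eqP=> [Qik|->//].
by rewrite -(gK k); congr f; apply: disj Qik; rewrite -{1}(gK k).
Qed.

(** The matrix c on the block i is the product of c on the blocks i and j with the
projection onto the block i, plus the complementary projection.  As X normalizes
the base group and permutes projections, the conjugate of this matrix has the
same shape.  The determinant-one part and a single such matrix of determinant
-1 generate the wreath product. *)
Lemma block_wreath_conj : (1 < #|T|)%N -> (forall b, base_conj b -> base_det1 b) ->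
  (forall i, exists Q : {set T}, X *m block_proj i
    = diag_blocks (fun k => if k \in Q then 1%:M else 0) *m X) ->
  forall M, block_wreath M -> block_wreath (X *m M *m invmx X).
Proof.
move=> T_gt1 FB /block_proj_perm[f fP].
have single_conj i c : C c -> block_wreath (X *m single_mx i c *m invmx X).
  move=> Cc; have [j neq] : exists j, i != j.
    have /card_gt1P[x [y [_ _ neq]]] := T_gt1.
    by case: (eqVneq i x) => [->|ne]; [exists y | exists x].
  have Bij := base_det1_pair neq Cc.
  have [A [CA eA dA]] := FB _ (base_conjI Bij).
  have -> : X *m single_mx i c *m invmx X = single_mx (f i) (A (f i)).
    have -> : single_mx i c = single_mx i c *m single_mx j c *m block_proj i + (1%:M -
      block_proj i).
      rewrite {1}single_block_proj !diag_blocksM; congr (_ + _);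
        apply: eq_diag_blocks => k; rewrite /single_block.
      case: (eqVneq k i) => [->|_]; last by rewrite mulmx0.
      by rewrite (negPf neq) !mulmx1.
    have eB : X *m (single_mx i c *m single_mx j c) = diag_blocks A *m X
      by rewrite -eA mulmxKV.
    rewrite mulmxDr mulmxBr mulmx1 fP mulmxA eB -mulmxA fP mulmxA.
    rewrite -{2}[X]mul1mx -mulmxBl -mulmxDl mulmxK // diag_blocksM single_block_proj;
      congr (_ + _).
    by apply: eq_diag_blocks => k; case: eqP => [->|_]; rewrite ?mulmx1 ?mulmx0.
  by apply: block_wreath_diag; apply: D_single_block.
move=> M RM; have [i _] := card_gt0P (ltnW T_gt1).
case: (block_wreath_det_fix i RM) => dM; first by have [] := XS (conj RM dM).
have [Z' CZ' ZK] := ws_inv W (ws_Z W).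
have RM1 : block_wreath (single_mx i Z *m M).
  by apply: block_wreathM => //; apply: block_wreath_diag; apply: D_single_block;
    apply: (ws_Z W).
have -> : M = single_mx i Z' *m (single_mx i Z *m M).
  by rewrite mulmxA single_blockM ZK single_block1 mul1mx.
have -> : X *m (single_mx i Z' *m (single_mx i Z *m M)) *m invmx X =
  (X *m single_mx i Z' *m invmx X) *m (X *m (single_mx i Z *m M) *m invmx X).
  by rewrite !mulmxA mulmxKV.
apply: block_wreathM; first exact: single_conj.
by have [] := XS (conj RM1 dM).
Qed.

(** C is cyclic of order at least 8 in the applications; Z is a generator. *)
Section LargeBase.

Hypothesis T_gt1 : (1 < #|T|)%N.
Hypothesis P_trans : forall i j, exists2 s, s \in P & s i = j.
Hypothesis Z4_neq1 : (Z *m Z) *m (Z *m Z) != 1%:M.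
Hypothesis C_invol : forall c, C c -> c *m c = 1%:M -> c = 1%:M \/ c = - 1%:M.
Hypothesis C_N1 : C (- 1%:M) /\ \det (- 1%:M : 'M[K]_n) = 1.
Hypothesis D_pow4 : forall d, D d -> (d *m d) *m (d *m d) != 1%:M -> C d.
Hypothesis D_cent : forall c d, C c -> D d -> (c *m c) *m (c *m c) != 1%:M ->
  c *m d = d *m c -> C d.

(** Let M in F have block permutation s with s i <> i, and let M' be its conjugate by
u = Z ^ 2 on the block i, again in F.  The blocks of M' differ from those of M
only in the rows i and s^-1 i, by a factor u.  Comparing the rows i and s i of
M M' = M' M gives u = 1 if s (s i) <> i and u ^ 2 = 1 otherwise. *)
Lemma base_conj_diag M : base_conj M -> exists2 A, (forall i, D (A i)) & M = diag_blocks A.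
Proof.
move=> FM; have [[A [s [DA Ps eM]]] _] := base_conj_block_wreath1 FM.
suff s1 : s = 1%g by exists A => //; rewrite eM s1.
apply/permP=> i; rewrite perm1; apply/eqP; apply: contraT => neq.
have nzA k : A k != 0 by apply: ws_neq0.
have uA k : A k \in unitmx by apply: (ws_unit W).
set u := Z *m Z; have Cu : C u by apply: (ws_mul W); apply: (ws_Z W).
have Sy : block_wreath1 (single_mx i u).
  apply: base_det1_block_wreath1; exists (single_block i u); split=> //;
    first exact: C_single_block.
  by rewrite det_single_block det_mulmx (ws_detZ W) mulrNN mulr1.
have [M' FM' eq1] := base_conj_norm Sy FM.
have [[A' [s' [DA' Ps' eM']]] _] := base_conj_block_wreath1 FM'.
have eq2 := base_conj_comm FM FM'.
move: eq1 eq2; rewrite eM eM' diag_monomial monomial_diag !monomialM.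
have uat k : single_block i u k \in unitmx.
  by apply: (ws_unit W); apply: D_single_block.
have nzM k : single_block i u k *m A k != 0.
  by apply: ws_neq0; apply: (ws_mulD W); rewrite //; apply: D_single_block.
move/(monomial_inj nzM) => [eqs eqA].
have nzM2 k : A k *m A' (s k) != 0 by apply: ws_neq0; apply: (ws_mulD W).
move/(monomial_inj nzM2) => [_ eqAA]; subst s'.
have A'i : A' i = u *m A i.
  by have := eqA i; rewrite /single_block eqxx (negPf neq) mulmx1.
have A'si := eqA (s i); rewrite {1}/single_block (negPf neq) mul1mx in A'si.
case: (eqVneq (s (s i)) i) => [ssi|nssi].
  rewrite /single_block ssi eqxx in A'si.
  have := eqAA (s i); rewrite ssi A'i {1}A'si => eqf.
  have uA'si : A' (s i) \in unitmx by apply: (ws_unit W).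
  have {eqf} : A' (s i) *m (u *m u) *m A i = A' (s i) *m A i by rewrite -eqf !mulmxA.
  move/(can_inj (mulmxK (uA i))); rewrite -[RHS]mulmx1 => /(can_inj (mulKmx uA'si)).
  by move/eqP; rewrite (negPf Z4_neq1).
rewrite /single_block (negPf nssi) mulmx1 in A'si.
have := eqAA i; rewrite A'i -A'si -mulmxA -{1}[A i *m _]mul1mx.
have uAA : A i *m A (s i) \in unitmx by rewrite unitmx_mul !uA.
move/(can_inj (mulmxK uAA)) => u1.
by case/negP: Z4_neq1; rewrite -/u -u1 mulmx1.
Qed.

(** The conjugate of Z on two blocks has, at some place l, a block whose fourth
power is not 1.  Conjugating by an element of the wreath product that permutes
l to k gives such a block at the place k.  It commutes with the k-th block of M,
which is therefore in C. *)
Lemma base_conj_sub_base M : base_conj M -> base_det1 M.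
Proof.
move=> FM; have [A DA eM] := base_conj_diag FM; have [_ dM] := base_conj_block_wreath1 FM.
exists A; split=> // k.
have [i [j [_ _ neq]]] := card_gt1P T_gt1.
have B0 := base_det1_pair neq (ws_Z W).
have F0 := base_conjI B0; set M0 := X *m _ *m _ in F0.
have [B DB eM0] := base_conj_diag F0.
have [l nl] : exists l, (B l *m B l) *m (B l *m B l) != 1%:M.
  apply/existsP; apply: contraT; rewrite negb_exists => /forallP B4.
  have M04 : (M0 *m M0) *m (M0 *m M0) = 1%:M.
    rewrite eM0 !diag_blocksM -diag_blocks1; apply: eq_diag_blocks => l.
    by apply/eqP; move: (B4 l); rewrite negbK.
  set b := single_mx i Z *m single_mx j Z in B0 M0 F0 eM0 M04.
  have M0X : M0 *m X = X *m b by rewrite mulmxKV.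
  have M02X : M0 *m M0 *m X = X *m (b *m b).
    by rewrite -mulmxA M0X mulmxA M0X -mulmxA.
  have : (M0 *m M0) *m (M0 *m M0) *m X = X *m ((b *m b) *m (b *m b)).
    by rewrite -mulmxA M02X mulmxA M02X -mulmxA.
  rewrite M04 mul1mx -[LHS]mulmx1 => /(can_inj (mulKmx Xunit)).
  rewrite /b !diag_blocksM -diag_blocks1 => /diag_blocks_inj/(_ i);
    rewrite /single_block eqxx (negPf neq) !mulmx1.
  by move/esym/eqP; rewrite (negPf Z4_neq1).
have [p Pp pk] := P_trans k l.
have [A1 CA1 Sp] := block_wreath1_lift i Pp.
have [M1 FM1 eq1] := base_conj_norm Sp F0.
have [B1 DB1 eM1] := base_conj_diag FM1.
rewrite eM0 eM1 monomial_diag diag_monomial in eq1.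
have nz1 x : A1 x *m B (p x) != 0.
  by apply: ws_neq0; apply: (ws_mulD W); rewrite //; apply: (ws_sub W).
have [_ /(_ k)] := monomial_inj nz1 eq1; rewrite pk => eqk.
have uA1 : A1 k \in unitmx by apply/(ws_unit W)/(ws_sub W).
have B1k4 : (B1 k *m B1 k) *m (B1 k *m B1 k) != 1%:M.
  apply: contra nl => /eqP B14; apply/eqP.
  apply: (can_inj (mulKmx uA1)); rewrite mulmx1.
  have e2 : A1 k *m (B l *m B l) = B1 k *m B1 k *m A1 k.
    by rewrite mulmxA eqk -mulmxA eqk mulmxA.
  by move: e2 B14; set b := B l *m B l; set b1 := B1 k *m B1 k => e2 B14;
    rewrite mulmxA e2 -mulmxA e2 mulmxA B14 mul1mx.
have CB1 := D_pow4 (DB1 k) B1k4.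
apply: D_cent CB1 (DA k) B1k4 _.
have := base_conj_comm FM1 FM; rewrite eM eM1 !diag_blocksM.
by move/diag_blocks_inj/(_ k).
Qed.

(** Twice the projection onto the block i is 1 minus the matrix that is -1 on the
block i; the latter goes to an involution in the base group, whose blocks are 1
or -1. *)
Theorem block_wreath_conj_large M : block_wreath M -> block_wreath (X *m M *m invmx X).
Proof.
apply: block_wreath_conj => // [b|i]; first exact: base_conj_sub_base.
have [CN1 dN1] := C_N1.
have Be : base_det1 (single_mx i (- 1%:M)).
  by exists (single_block i (- 1%:M)); split=> //;
    [apply: C_single_block | rewrite det_single_block].
have [A [CA eA _]] := base_conj_sub_base (base_conjI Be).
have XA : X *m single_mx i (- 1%:M) = diag_blocks A *m X by rewrite -eA mulmxKV.
have A1 k : A k = 1%:M \/ A k = - 1%:M.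
  apply: C_invol => //.
  suff: diag_blocks A *m diag_blocks A = 1%:M
    by rewrite diag_blocksM -diag_blocks1 => /diag_blocks_inj/(_ k).
  apply: (can_inj (mulmxK Xunit)); rewrite -mulmxA -XA mulmxA -XA -mulmxA single_blockM.
  by rewrite mulNmx mulmxN opprK mulmx1 single_block1 mulmx1 mul1mx.
exists [set k | A k != 1%:M].
have two_neq0 := ws_two W.
have half : forall N (B B' : 'M[K]_N), B + B = B' + B' -> B = B'.
  move=> N B B'; rewrite -!mulr2n -!scaler_nat => eqB.
  by rewrite -[B]scale1r -(mulVf two_neq0) -scalerA eqB scalerA mulVf // scale1r.
apply: half; rewrite -(mulmxDr X) -(mulmxDl _ _ X).
have -> : block_proj i + block_proj i = 1%:M - single_mx i (- 1%:M).
  rewrite -diag_blocks1 diag_blocksN !diag_blocksD; apply: eq_diag_blocks => k;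
    rewrite /single_block; case: eqP => _.
    by rewrite opprK.
  by rewrite addr0 subrr.
rewrite mulmxBr mulmx1 XA -{1}[X]mul1mx -mulmxBl; congr (_ *m _).
rewrite -diag_blocks1 diag_blocksN !diag_blocksD; apply: eq_diag_blocks => k; rewrite inE.
case: (A1 k) => ->; first by rewrite eqxx subrr addr0.
rewrite opprK; case: eqP => //= /eqP.
rewrite -subr_eq0 -opprD oppr_eq0 -mulr2n -scaler_nat scaler_eq0 (negPf two_neq0).
by rewrite (negPf ws_one_neq0).
Qed.

End LargeBase.
End Wreath.

(** * The base group of sign changes *)
Section Signs.
Variables (K : fieldType) (n : nat).
Hypothesis two_neq0 : (2 : K) != 0.
Hypothesis n_gt0 : (0 < n)%N.

Definition sign_mx (b : bool) : 'M[K]_n := if b then - 1%:M else 1%:M.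

Lemma sign_mxM b b' : sign_mx b *m sign_mx b' = sign_mx (b (+) b').
Proof. by case: b b' => -[]; rewrite /= ?mulmxN ?mulNmx ?opprK mulmx1. Qed.

Lemma sign_mx_inj : injective sign_mx.
Proof.
have neq : (1%:M : 'M[K]_n) <> - 1%:M.
  move=> /matrixP/(_ (Ordinal n_gt0) (Ordinal n_gt0)); rewrite !mxE eqxx => /eqP.
  by rewrite -subr_eq0 opprK (negPf two_neq0).
by case=> -[] // /esym.
Qed.

End Signs.

Section SignWreath.
Variables (K : fieldType) (T : finType) (n : nat) (P : {set {perm T}}).
Local Notation sign_mx := (sign_mx K n).

Definition sign_group (d : 'M[K]_n) : Prop := exists b, d = sign_mx b.

Hypothesis W : wreath_spec sign_group sign_group P (- 1%:M).
Hypothesis T_gt4 : (4 < #|T|)%N.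

Variable X : 'M[K]_(#|T| * n).
Hypothesis Xunit : X \in unitmx.
Hypothesis XS : forall M, block_wreath1 sign_group P M ->
  block_wreath1 sign_group P (X *m M *m invmx X).
Hypothesis XS' : forall M, block_wreath1 sign_group P M ->
  block_wreath1 sign_group P (invmx X *m M *m X).

Local Notation F := (@base_conj K _ n sign_group X).

Definition signed_perm_mx (B : {set T}) (s : {perm T}) :=
  monomial_mx (fun i => sign_mx (i \in B)) s.

Lemma signed_perm_inj B s B' s' : signed_perm_mx B s = signed_perm_mx B' s' ->
  B = B' /\ s = s'.
Proof.
rewrite /signed_perm_mx => eqM; have nz i : sign_mx (i \in B) != 0 by apply: (ws_neq0 W);
  exists (i \in B).
have [-> eqA] := monomial_inj nz eqM; split=> //; apply/setP=> i.
by apply: (sign_mx_inj (ws_two W) (ws_n W)); apply: eqA.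
Qed.

Lemma signed_permM B s B' s' :
  signed_perm_mx B s *m signed_perm_mx B' s'
    = signed_perm_mx [set i | (i \in B) (+) (s i \in B')] (s * s')%g.
Proof.
by rewrite /signed_perm_mx monomialM; apply: eq_monomial => i; rewrite sign_mxM inE.
Qed.

Lemma signed_perm_set0 : signed_perm_mx set0 1%g = 1%:M.
Proof. by rewrite -diag_blocks1; apply: eq_monomial => i; rewrite inE. Qed.

Lemma signed_perm_unit B s : s \in P -> signed_perm_mx B s \in unitmx.
Proof.
move=> Ps; have R : block_wreath sign_group P (signed_perm_mx B s).
  by exists (fun i => sign_mx (i \in B)), s; split=> // i; exists (i \in B).
rewrite unitmxE; case: (ws_det W R) => ->; rewrite ?unitr1 //.
by rewrite unitrN unitr1.
Qed.

Lemma signed_permP M : block_wreath1 sign_group P M ->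
  exists B s, s \in P /\ M = signed_perm_mx B s.
Proof.
move=> [[A [s [DA Ps ->]]] _]; have [b bE] := fin_all_exists DA.
exists [set i | b i], s; split=> //.
by apply: eq_monomial => i; rewrite inE.
Qed.

Lemma base_conj_signed M : F M -> exists B s, s \in P /\ M = signed_perm_mx B s.
Proof. by move=> FM; apply/signed_permP/(base_conj_block_wreath1 W Xunit XS). Qed.

Lemma det_signs B : \det (signed_perm_mx B 1%g) = (-1) ^+ #|B|.
Proof.
rewrite -[LHS]/(\det (diag_blocks _)) det_diag_blocks -sum1_card -prodrXr /=.
rewrite [RHS]big_mkcond /=; apply: eq_bigr => i _.
by case: (i \in B); rewrite /= ?det1 // (ws_detZ W).
Qed.

Lemma base_det1_signs (Q : {set T}) : ~~ odd #|Q| ->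
  base_det1 sign_group (signed_perm_mx Q 1%g).
Proof.
move=> evQ; exists (fun i => sign_mx (i \in Q)); split=> // [i|]; first by exists (i \in Q).
by rewrite det_signs -signr_odd (negPf evQ).
Qed.

Lemma signs_sqr Q : signed_perm_mx Q 1%g *m signed_perm_mx Q 1%g = 1%:M.
Proof.
rewrite signed_permM mulg1 -signed_perm_set0; congr signed_perm_mx; apply/setP=> i.
by rewrite !inE perm1 addbb.
Qed.

(** Write Q for the sign change on an even set Q of blocks and f for the element of F
with permutation s.  The commutator of f and Q changes the sign on the set of i for
which exactly one of i and s i is in Q.  It lies in F, so it commutes with f',
which means that this set is stable under s'. *)
Lemma base_conj_parity B s B' s' (Q : {set T}) : F (signed_perm_mx B s) ->
  F (signed_perm_mx B' s') ->
  s \in P -> s' \in P ->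
  ~~ odd #|Q| -> forall i,
  (i \in Q) (+) (s i \in Q) = (s' i \in Q) (+) (s (s' i) \in Q).
Proof.
move=> Ff Ff' Ps Ps' evQ i.
have SQ := base_det1_block_wreath1 W (base_det1_signs evQ).
have [f2 Ff2 eq2] := base_conj_norm W Xunit XS' SQ Ff.
pose Q' := [set i | (i \in Q) (+) (s i \in Q)].
have ef2 : f2 = signed_perm_mx Q' 1%g *m signed_perm_mx B s.
  rewrite -[f2]mulmx1 -(signs_sqr Q) mulmxA -eq2 !signed_permM mulg1 mul1g;
    congr signed_perm_mx.
  by apply/setP=> x; rewrite !inE !perm1; case: (x \in Q); case: (x \in B); case: (_ \in Q).
have := base_conj_comm W Xunit Ff' Ff2;
  rewrite ef2 -[RHS]mulmxA (base_conj_comm W Xunit Ff Ff').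
rewrite !mulmxA => /(can_inj (mulmxK (signed_perm_unit B Ps))).
rewrite !signed_permM => /signed_perm_inj[/setP/(_ i)]; rewrite !inE !perm1 => eqb _.
move: eqb; rewrite (addbC (i \in B')) => /addIb.
by move=> <-.
Qed.

(** Apply the preceding lemma to Q = {a, b} with b outside {a, s a, s' a, s (s' a)}:
the point a is in the stable set, and s' a is not unless s' a = a or
s (s' a) = a. *)
Lemma base_conj_move B s B' s' a : F (signed_perm_mx B s) -> F (signed_perm_mx B' s') ->
  s \in P -> s' \in P -> s a != a -> s' a = a \/ s (s' a) = a.
Proof.
move=> Ff Ff' Ps Ps' sa.
case: (eqVneq (s' a) a) => [|s'a]; first by left.
case: (eqVneq (s (s' a)) a) => [|ss'a]; first by right.
have [b bP] : exists b, b \notin [:: a; s a; s' a; s (s' a)].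
  have := leq_ltn_trans (card_size [:: a; s a; s' a; s (s' a)]) T_gt4.
  rewrite -cardsT; case: (pickP [pred b | b \notin [:: a; s a; s' a;
    s (s' a)]]) => [b /= bP _|all_in].
    by exists b.
  rewrite cardsT ltnNge subset_leq_card //; apply/subsetP=> b _.
  by apply: contraFT (all_in b).
move: bP; rewrite !inE !negb_or => /and4P[ba bsa bs'a bss'a].
have evQ : ~~ odd #|[set a; b]| by rewrite cards2 eq_sym ba.
have := base_conj_parity Ff Ff' Ps Ps' evQ a; rewrite !inE eqxx /=.
rewrite (negPf sa) (negPf s'a) (negPf ss'a) /=.
by rewrite ![s _ == b]eq_sym [s' _ == b]eq_sym (negPf bsa) (negPf bs'a) (negPf bss'a).
Qed.

Lemma base_conj_perm_conj B s p : F (signed_perm_mx B s) -> s \in P -> p \in P ->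
  exists B' s',
  [/\ F (signed_perm_mx B' s'), s' \in P & forall i, s (p i) = p (s' i)].
Proof.
move=> Ff Ps Pp.
have [i0 _] : exists i0 : T, true
  by have /card_gt0P[i0 _] := ltn_trans (isT : 0 < 4)%N T_gt4; exists i0.
have [A _ Sp] := block_wreath1_lift W i0 Pp.
have [f2 Ff2 eq2] := base_conj_norm W Xunit XS' Sp Ff.
have [C [s' [Ps' ef2]]] := base_conj_signed Ff2.
have [A' [p' [_ eA]]] := signed_permP Sp.
exists C, s'; split=> //; first by rewrite -ef2.
have nz i : sign_mx (i \in A') != 0 by apply: (ws_neq0 W); exists (i \in A').
have ep : p' = p by have [] := monomial_inj nz (esym eA).
rewrite eA ep ef2 !signed_permM in eq2; have [_ /permP eqp] := signed_perm_inj eq2 => i.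
by have := eqp i; rewrite !permM.
Qed.

(** (1 - e) / 2 is the projection onto the blocks where the sign change e is -1; the
product of two of them projects onto the common blocks.  So the projection onto
one block comes from two pairs of blocks that share it. *)
Lemma sign_idempotent (B B' : {set T}) :
  (1%:M - signed_perm_mx B 1%g) *m (1%:M - signed_perm_mx B' 1%g) =
  (2 * 2 : K) *: diag_blocks (fun k => if k \in B :&: B' then 1%:M else 0).
Proof.
have scale_dg (z : K) (A : T -> 'M[K]_n) : z *: diag_blocks A
  = diag_blocks (fun i => z *: A i).
  apply: block_atP => i j.
  transitivity (z *: block_at (diag_blocks A) i j); first by apply/matrixP=> k l;
    rewrite !mxE.
  by rewrite !block_at_monomial; case: eqP; rewrite ?scaler0.
rewrite -diag_blocks1 -![signed_perm_mx _ _]/(diag_blocks _) !diag_blocksN !diag_blocksD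
  diag_blocksM scale_dg; apply: eq_diag_blocks => k.
rewrite inE; case: (k \in B); rewrite /= ?subrr ?mul0mx ?scaler0 //.
case: (k \in B'); rewrite /= ?subrr ?mulmx0 ?scaler0 // opprK.
by rewrite -mulr2n -scaler_nat -scalemxAl -scalemxAr mulmx1 scalerA.
Qed.

End SignWreath.

(** Here P is a group of permutations of U x V, U elementary abelian, that map fibers
over V to fibers by translations; every family of translations of the fibers
is in P. *)
Section SignAffine.
Variables (K : fieldType) (c1 : nat) (V : finType) (n : nat).
Local Notation U := ('rV['F_2]_c1).
Local Notation T := ((U * V)%type : finType).
Variable P : {set {perm T}}.
Local Notation sign_group := (@sign_group K n).
Local Notation sign_mx := (sign_mx K n).

Hypothesis W : wreath_spec sign_group sign_group P (- 1%:M).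
Hypothesis c1_gt1 : (1 < c1)%N.
Hypothesis T_gt4 : (4 < #|T|)%N.
Hypothesis P_form : forall s, s \in P ->
  exists (v : V -> U) (h : V -> V), forall x, s x = (x.1 + v x.2, h x.2).
Hypothesis P_transl : forall v : V -> U,
  exists2 s, s \in P & forall x, s x = (x.1 + v x.2, x.2).
Hypothesis P_trans : forall i j, exists2 s, s \in P & s i = j.

Variable X : 'M[K]_(#|T| * n).
Hypothesis Xunit : X \in unitmx.
Hypothesis XS : forall M, block_wreath1 sign_group P M ->
  block_wreath1 sign_group P (X *m M *m invmx X).
Hypothesis XS' : forall M, block_wreath1 sign_group P M ->
  block_wreath1 sign_group P (invmx X *m M *m X).

Local Notation F := (@base_conj K _ n sign_group X).
Local Notation signed_perm_mx := (@signed_perm_mx K T n).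

(** If s moves the fiber of x, conjugate it by a nontrivial translation of that fiber
only.  The result is s' with s' x <> s x, and both have to be the partner of x
given by [base_conj_move]. *)
Lemma base_conj_fix_blocks B s x : F (signed_perm_mx B s) -> s \in P -> (s x).2 = x.2.
Proof.
move=> Ff Ps; apply/eqP; apply: contraT => neq.
have [v [h sE]] := P_form Ps.
have sxx : s x != x by apply: contra neq => /eqP->.
pose z : U := const_mx 1.
have z_neq0 : z != 0.
  by apply/eqP=> /matrixP/(_ ord0 (Ordinal (ltnW c1_gt1))); rewrite !mxE.
have [p Pp pE] := P_transl (fun t => if t == x.2 then z else 0).
have [B' [s' [Ff' Ps' conjE]]] := base_conj_perm_conj W T_gt4 Xunit XS XS' Ff Ps Pp.
have ss : s (s x) = x by case: (base_conj_move W T_gt4 Xunit XS' Ff Ff Ps Ps sxx) =>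
  // /eqP; rewrite (negPf sxx).
have px : s (p x) = (x.1 + z + v x.2, h x.2) by rewrite pE sE /= eqxx.
have hx : h x.2 != x.2 by move: neq; rewrite sE.
have s'x2 : (s' x).2 = h x.2.
  by have := conjE x; rewrite px (pE (s' x)) => /(congr1 snd) /= <-.
have s'x : s' x = (x.1 + z + v x.2, h x.2).
  by rewrite -px conjE pE s'x2 (negPf hx) addr0 -s'x2; case: (s' x).
case: (base_conj_move W T_gt4 Xunit XS' Ff Ff' Ps Ps' sxx) => [eqx|].
  by case/eqP: hx; rewrite -s'x2 eqx.
rewrite -{2}ss => /perm_inj; rewrite s'x sE => -[/addIr/eqP].
by rewrite -subr_eq0 addrC addKr (negPf z_neq0).
Qed.

Lemma base_conj_transl B s : F (signed_perm_mx B s) -> s \in P ->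
  exists v : V -> U, forall x, s x = (x.1 + v x.2, x.2).
Proof.
move=> Ff Ps; have [v [h sE]] := P_form Ps; exists v => x.
by have := base_conj_fix_blocks x Ff Ps; rewrite !sE /= => hx; rewrite hx.
Qed.

(** Suppose that some s moves a point.  By transitivity every point k is moved, and
by [base_conj_move] there is a single io k to which elements of F can move it; io is
an involution without fixed points.  On a fiber, s is io or the identity, so s
is determined by the set of fibers that it moves.  Two elements of F with the same
permutation differ by a sign change in F, which commutes with all of F and so
is invariant under io; it is trivial if the signs agree on the half H of the points.
Counting the sets Q of blocks by the parity of Q and by these two data
of the conjugate of Q gives |T| <= 1 + |V| + |H| <= 1 + |T| / 4 + |T| / 2, that is
|T| <= 4. *)
Lemma base_conj_perm1 B s : F (signed_perm_mx B s) -> s \in P -> s = 1%g.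
Proof.
move=> Ff Ps; apply/permP=> a; rewrite perm1; apply/eqP; apply: contraT => sa.
have [i0 _] : exists i0 : T, true by exists a.
(* The partner of a point, from an element of F that moves it. *)
have ex_io k : exists l, l != k /\
    exists B1 s1, [/\ F (signed_perm_mx B1 s1), s1 \in P & s1 k = l].
  have [p Pp pk] := P_trans k a.
  have [B1 [s1 [F1 Ps1 s1E]]] := base_conj_perm_conj W T_gt4 Xunit XS XS' Ff Ps Pp.
  exists (s1 k); split; last by exists B1, s1.
  by apply: contra sa => /eqP eqk; rewrite -pk s1E eqk.
have [io ioP] := fin_all_exists ex_io.
have io_neq k : io k != k by have [] := ioP k.
have io_or B1 s1 k : F (signed_perm_mx B1 s1) -> s1 \in P -> s1 k != k -> s1 k = io k.
  move=> F1 Ps1 s1k; have [_ [B2 [s2 [F2 Ps2 s2k]]]] := ioP k.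
  have s2kk : s2 k != k by rewrite s2k.
  have s22 : s2 (s2 k) = k by case: (base_conj_move W T_gt4 Xunit XS' F2 F2 Ps2 Ps2 s2kk)
    => // /eqP; rewrite (negPf s2kk).
  case: (base_conj_move W T_gt4 Xunit XS' F2 F1 Ps2 Ps1 s2kk) => [/eqP|];
    first by rewrite (negPf s1k).
  by rewrite -{2}s22 => /perm_inj ->.
have ioK k : io (io k) = k.
  have [_ [B2 [s2 [F2 Ps2 s2k]]]] := ioP k.
  have s2kk : s2 k != k by rewrite s2k.
  have s22 : s2 (s2 k) = k by case: (base_conj_move W T_gt4 Xunit XS' F2 F2 Ps2 Ps2 s2kk)
    => // /eqP; rewrite (negPf s2kk).
  by rewrite -(io_or _ _ _ F2 Ps2) -?s2k ?s22 // eq_sym.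
pose H := [set k | (enum_rank k < enum_rank (io k))%N].
have H_io k : k \in H \/ io k \in H.
  rewrite !inE ioK; case: ltngtP => // [_|_|/val_inj/enum_rank_inj/esym/eqP].
  - by left.
  - by right.
  - by rewrite (negPf (io_neq k)).
have cardH : (#|H| + #|H| <= #|T|)%N.
  rewrite -{2}(card_imset _ (can_inj ioK)) -cardsUI.
  have -> : H :&: io @: H = set0.
    apply/setP=> k; rewrite !inE; apply/negP=> /andP[lt1 /imsetP[l]].
    rewrite !inE => lt2 ek; move: lt1; rewrite ek ioK ltnNge.
    by rewrite (ltnW lt2).
  by rewrite cards0 addn0 max_card.
have exR (Q : {set T}) : exists r : {set T} * {perm T}, ~~ odd #|Q| ->
    [/\ F (signed_perm_mx r.1 r.2), r.2 \in P & X *m signed_perm_mx Q 1%g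
      = signed_perm_mx r.1 r.2 *m X].
  case: (boolP (odd #|Q|)) => [_|evQ]; first by exists (set0, 1%g).
  have FQ := base_conjI Xunit (base_det1_signs W evQ).
  have [B1 [s1 [Ps1 e1]]] := base_conj_signed W Xunit XS FQ.
  exists (B1, s1) => _; split=> //=; first by rewrite -e1.
  by rewrite -e1 mulmxKV.
have [r rP] := fin_all_exists exR.
(* Only even sets are in the base group: odd ones are changed at a fixed point i0. *)
pose ev (Q : {set T}) : {set T} := if odd #|Q| then (if i0 \in Q then Q :\ i0 else i0 |: Q)
  else Q.
have ev_even Q : ~~ odd #|ev Q|.
  rewrite /ev; case: (boolP (odd #|Q|)) => // odQ.
  case: (boolP (i0 \in Q)) => i0Q; last by rewrite cardsU1 i0Q /= odQ.
  by move: odQ; rewrite (cardsD1 i0 Q) i0Q /=.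
have evE Q i : (i \in ev Q) = (i \in Q) (+) (odd #|Q| && (i == i0)).
  rewrite /ev; case: ifP => _; last by rewrite addbF.
  case: ifP => i0Q; rewrite !inE; case: eqP => [->|]; rewrite ?i0Q ?addbF //.
pose Phi (Q : {set T}) := (odd #|Q|, [set t | (r (ev Q)).2 (0, t) != (0, t)],
  (r (ev Q)).1 :&: H).
have Phi_inj : injective Phi.
  move=> Q1 Q2 [eq_odd /setP eqW /setP eqB].
  have [F1 Ps1 X1] := rP _ (ev_even Q1); have [F2 Ps2 X2] := rP _ (ev_even Q2).
  case: (r (ev Q1)) F1 Ps1 X1 eqW eqB => B1 s1 /= F1 Ps1 X1.
  case: (r (ev Q2)) F2 Ps2 X2 => B2 s2 /= F2 Ps2 X2 eqW eqB.
  have eqs : s1 = s2.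
    apply/permP=> -[u t].
    have [v1 s1E] := base_conj_transl F1 Ps1; have [v2 s2E] := base_conj_transl F2 Ps2.
    have addr_eq (w w' : U) : (w + w' == w) = (w' == 0).
      by rewrite -{2}[w]addr0 (inj_eq (addrI w)).
    have mv1 w : (s1 (w, t) != (w, t)) = (v1 t != 0).
      by rewrite s1E xpair_eqE eqxx andbT /= addr_eq.
    have mv2 w : (s2 (w, t) != (w, t)) = (v2 t != 0).
      by rewrite s2E xpair_eqE eqxx andbT /= addr_eq.
    have := eqW t; rewrite !inE mv1 mv2 => eqv.
    case: (eqVneq (s1 (u, t)) (u, t)) => [e1|n1].
      by apply/esym/eqP; rewrite e1 -[_ == _]negbK mv2 -eqv -(mv1 u) e1 eqxx.
    by rewrite (io_or _ _ _ F1 Ps1 n1) (io_or _ _ _ F2 Ps2) // mv2 -eqv -(mv1 u).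
  subst s2.
  pose Q3 := [set i | (i \in ev Q1) (+) (i \in ev Q2)].
  have bQ3 : signed_perm_mx Q3 1%g
    = signed_perm_mx (ev Q1) 1%g *m signed_perm_mx (ev Q2) 1%g.
    by rewrite signed_permM mulg1; congr signed_perm_mx; apply/setP=> i; rewrite !inE perm1.
  have F3 : F (X *m signed_perm_mx Q3 1%g *m invmx X).
    apply: base_conjI => //; rewrite bQ3.
    by apply: (base_det1M W); apply: (base_det1_signs W); apply: ev_even.
  have [B3 [s3 [Ps3 e3]]] := base_conj_signed W Xunit XS F3; rewrite e3 in F3.
  have e321 : signed_perm_mx B3 s3 *m signed_perm_mx B2 s1 = signed_perm_mx B1 s1.
    apply: (can_inj (mulmxK Xunit)); rewrite -mulmxA -X1 -X2 -e3 !mulmxA mulmxKV //.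
    by rewrite bQ3 -!mulmxA signs_sqr mulmx1.
  move: e321; rewrite signed_permM => /(signed_perm_inj W)[eB3 es3].
  have {es3} s31 : s3 = 1%g by apply: (mulIg s1); rewrite es3 mul1g.
  subst s3.
  have B3H i : i \in H -> i \notin B3.
    move=> iH; have := eqB i; rewrite -eB3 !in_setI iH !andbT inE perm1.
    by case: (i \in B3); case: (i \in B2).
  have B3io k : (k \in B3) = (io k \in B3).
    have [_ [B4 [s4 [F4 Ps4 s4k]]]] := ioP k.
    have := base_conj_comm W Xunit F3 F4;
      rewrite !signed_permM => /(signed_perm_inj W)[/setP/(_ k)].
    rewrite !inE perm1 s4k => eqk _.
    by move: eqk; case: (k \in B3); case: (k \in B4); case: (io k \in B3).
  have B30 : B3 = set0.
    apply/setP=> k; rewrite inE; case: (H_io k) => /B3H/negPf // <-.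
    exact: B3io.
  have : X *m signed_perm_mx Q3 1%g = X.
    by rewrite -[LHS](mulmxKV Xunit) e3 B30 signed_perm_set0 mul1mx.
  rewrite -[RHS]mulmx1 => /(can_inj (mulKmx Xunit));
    rewrite -signed_perm_set0 => /(signed_perm_inj W)[/setP Q30 _].
  apply/setP=> i; have := Q30 i; rewrite !inE !evE -eq_odd.
  by case: (i \in Q1); case: (i \in Q2); case: (_ && _).
have cardPhi : (#|{set T}| <= #|setX (setX [set: bool] (powerset [set: V])) (powerset
  H)|)%N.
  rewrite -cardsT -(card_imset _ Phi_inj); apply: subset_leq_card.
  apply/subsetP=> _ /imsetP[Q _ ->]; rewrite !inE /= subsetIr andbT.
  exact: subsetT.
have cardS : #|{set T}| = (2 ^ #|T|)%N.
  by rewrite -[in RHS]cardsT -card_powerset powersetT cardsT.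
move: cardPhi; rewrite cardS !cardsX !card_powerset !cardsT card_bool.
have -> : (2 * 2 ^ #|V| * 2 ^ #|H| = 2 ^ (1 + #|V| + #|H|))%N by rewrite !expnD.
rewrite leq_exp2l // card_prod => leU.
have cardU : (4 <= #|{: U}|)%N.
  by rewrite card_mx card_Fp // mul1n (@leq_exp2l 2 2).
have cardH' := cardH; have T_gt4' := T_gt4.
rewrite card_prod in cardH' T_gt4'.
have count u v h : (4 <= u -> h + h <= u * v -> 4 < u * v -> u * v <= 1 + v + h -> False)%N.
  move=> u_ge4; have : (4 * v <= u * v)%N by rewrite leq_mul2r u_ge4 orbT.
  by move: (u * v)%N => w; lia.
by case: (count _ _ _ cardU cardH' T_gt4' leU).
Qed.

Lemma sign_base_conj_sub_base M : F M -> base_det1 sign_group M.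
Proof.
move=> FM; have [_ dM] := base_conj_block_wreath1 W Xunit XS FM.
have [B [s [Ps eM]]] := base_conj_signed W Xunit XS FM; rewrite eM in FM dM *.
have s1 := base_conj_perm1 FM Ps; subst s.
by exists (fun i => sign_mx (i \in B)); split=> // i; exists (i \in B).
Qed.

(** The projection onto the block i is obtained from the sign changes on {i, j} and on
{i, k}, for three distinct blocks i, j and k. *)
Theorem block_wreath_conj_sign M : block_wreath sign_group P M ->
  block_wreath sign_group P (X *m M *m invmx X).
Proof.
apply: (block_wreath_conj W Xunit XS) => [|b|i].
- exact: leq_trans T_gt4.
- exact: sign_base_conj_sub_base.
have [j [k [ij ik jk]]] : exists j k, [/\ i != j, i != k & j != k].
  have cT : (2 < #|[set~ i]|)%N by rewrite cardsC1 -ltnS (ltn_predK T_gt4) ltnW.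
  have /card_gt1P[j [k [ji ki jk]]] := ltnW cT.
  exists j, k; rewrite !inE in ji ki; split=> //; by rewrite eq_sym.
have setE : block_proj K n i = diag_blocks (fun l => if l \in [set i; j] :&: [set i;
  k] then 1%:M else 0).
  apply: eq_diag_blocks => l; rewrite !inE; case: (eqVneq l i) => //= _.
  by case: (eqVneq l j) => // ->; rewrite (negPf jk).
have Xe l : i != l -> exists B, X *m signed_perm_mx [set i;
  l] 1%g = signed_perm_mx B 1%g *m X.
  move=> il; have evl : ~~ odd #|[set i; l]| by rewrite cards2 il.
  have Fl := base_conjI Xunit (base_det1_signs W evl).
  have [B [s [Ps eB]]] := base_conj_signed W Xunit XS Fl; have Fl2 := Fl; rewrite eB in Fl2.
  have s1 := base_conj_perm1 Fl2 Ps; subst s; exists B.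
  by rewrite -eB mulmxKV.
have [B XB] := Xe j ij; have [B' XB'] := Xe k ik.
exists (B :&: B').
have two2 : (2 * 2 : K) != 0 by rewrite mulf_neq0 ?(ws_two W).
apply: (can_inj (scalerK two2)); rewrite scalemxAr scalemxAl setE.
rewrite -(sign_idempotent K n [set i; j]) -(sign_idempotent K n B).
rewrite mulmxA (mulmxBr X) mulmx1 XB -{1}[X]mul1mx -(mulmxBl _ _ X) -!mulmxA;
  congr (_ *m _).
by rewrite mulmxBr mulmx1 XB' -{1}[X]mul1mx -mulmxBl.
Qed.

End SignAffine.

(** * Iterated wreath products of regular elementary abelian groups *)
Section IteratedWreath.

Lemma regularP c (s : {perm 'rV['F_2]_c}) :
  reflect (exists v, forall u, s u = u + v) (s \in regular_elem_abelian c).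
Proof.
rewrite inE; apply: (iffP existsP) => -[v sE]; exists v.
  by move=> u; apply/eqP; apply: (forallP sE).
by apply/forallP=> u; rewrite sE.
Qed.

Lemma wreath_permP (S T : finType) (G : {set {perm S}}) (H : {set {perm T}})
    (s : {perm (S * T)%type}) :
  reflect (exists (g : T -> {perm S}) h,
             [/\ forall t, g t \in G, h \in H & forall x, s x = (g x.2 x.1, h x.2)])
          (s \in wreath_perm G H).
Proof.
rewrite inE; apply: (iffP exists_inP) =>
  [[h Hh /existsP[g /andP[/forallP Gg /forallP sE]]]|].
  by exists g, h; split=> // x; apply/eqP.
case=> g [h [Gg Hh sE]]; exists h => //; apply/existsP; exists (finfun g).
apply/andP; split; first by apply/forallP=> t; rewrite ffunE.
by apply/forallP=> x; rewrite ffunE sE.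
Qed.

Lemma wreath_perm_elem (S T : finType) (G : {set {perm S}}) (H : {set {perm T}})
    (g : T -> {perm S}) h : (forall t, g t \in G) -> h \in H ->
  exists2 s, s \in wreath_perm G H & forall x, s x = (g x.2 x.1, h x.2).
Proof.
move=> Gg Hh.
have inj : injective (fun x : S * T => (g x.2 x.1, h x.2)).
  by move=> [u t] [u' t'] /= [eqg /perm_inj eqt]; move: eqg; rewrite eqt => /perm_inj->.
exists (perm inj); last by move=> x; rewrite permE.
by apply/wreath_permP; exists g, h; split=> // x; rewrite permE.
Qed.

Lemma regular_elem c (v : 'rV['F_2]_c) :
  exists2 s, s \in regular_elem_abelian c & forall u, s u = u + v.
Proof.
exists (perm (addIr v)); last by move=> u; rewrite permE.
by apply/regularP; exists v => u; rewrite permE.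
Qed.

Lemma Aseq1 c : 1%g \in Aseq c.
Proof.
elim: c => [|c1 c IHc]; first by rewrite inE.
apply/wreath_permP; exists (fun _ => 1%g), 1%g; split=> // [t|x].
  by apply/regularP; exists 0 => u; rewrite perm1 addr0.
by rewrite !perm1 -surjective_pairing.
Qed.

Lemma AseqM c s t : s \in Aseq c -> t \in Aseq c -> (s * t)%g \in Aseq c.
Proof.
elim: c s t => [|c1 c IHc] s t; first by rewrite !inE => /eqP-> /eqP->; rewrite mulg1.
move=> /wreath_permP[g [h [Gg Hh sE]]] /wreath_permP[g' [h' [Gg' Hh' tE]]].
apply/wreath_permP; exists (fun x => g x * g' (h x))%g, (h * h')%g; split.
- move=> x; have /regularP[v vE] := Gg x; have /regularP[v' v'E] := Gg' (h x).
  by apply/regularP; exists (v + v') => u; rewrite permM vE v'E addrA.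
- exact: IHc.
- by move=> x; rewrite !permM sE tE.
Qed.

Lemma Aseq_trans c i j : exists2 s, s \in Aseq c & s i = j.
Proof.
elim: c i j => [|c1 c IHc] /= i j; first by exists 1%g; rewrite ?inE //;
  case: (_ i) j => -[].
have [h Hh hE] := IHc i.2 j.2; have [g Gg gE] := regular_elem (j.1 - i.1).
have [s Ss sE] := wreath_perm_elem (g := fun _ => g) (fun _ => Gg) Hh.
by exists s => //; rewrite sE gE hE addrC subrK -surjective_pairing.
Qed.

Lemma card_points c : #|points c| = (2 ^ sumn c)%N.
Proof.
elim: c => [|c1 c IHc] /=; first exact: card_unit.
by rewrite card_prod IHc card_mx card_Fp // mul1n expnD.
Qed.

Lemma Aseq_form c1 c s : s \in Aseq (c1 :: c) ->
  exists (v : points c -> 'rV['F_2]_c1) (h : points c -> points c),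
    forall x, s x = (x.1 + v x.2, h x.2).
Proof.
move=> /wreath_permP[g [h [Gg Hh sE]]].
have exv t : exists v, forall u, g t u = u + v by apply/regularP.
have [v vE] := fin_all_exists exv.
by exists v, h => x; rewrite sE vE.
Qed.

Lemma Aseq_transl c1 c (v : points c -> 'rV['F_2]_c1) :
  exists2 s, s \in Aseq (c1 :: c) & forall x, s x = (x.1 + v x.2, x.2).
Proof.
have exg t : exists g, g \in regular_elem_abelian c1 /\ forall u, g u = u + v t.
  by have [g Gg gE] := regular_elem (v t); exists g.
have [g gP] := fin_all_exists exg.
have Gg t : g t \in regular_elem_abelian c1 by have [] := gP t.
have [s Ss sE] := wreath_perm_elem Gg (Aseq1 c).
by exists s => // x; rewrite sE perm1; have [_ ->] := gP x.2.
Qed.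

End IteratedWreath.

(** * The Frobenius map F and the F-stable torus *)
Section TwoPart.

Lemma expr_gcd (R : pzRingType) (y : R) i j :
  (0 < i)%N -> y ^+ i = 1 -> y ^+ j = 1 -> y ^+ gcdn i j = 1.
Proof.
move=> i_gt0 yi yj; have [u v eq_uv _] := egcdnP j i_gt0.
have := exprM y i u; rewrite yi expr1n mulnC eq_uv exprD mulnC exprM yj expr1n mul1r.
by [].
Qed.

Lemma dvdn_sqr_pred (q a : nat) (eta : int) : odd q -> eta = 1 \/ eta = -1 ->
  (2 ^ a %| `|(q%:Z + eta)%R|)%N -> (2 ^ a.+1 %| q ^ 2 - 1)%N.
Proof.
move=> q_odd eta_def a_dvd; have q_gt0 : (0 < q)%N by case: q q_odd {a_dvd}.
have -> : (q ^ 2 - 1 = (q - 1) * (q + 1))%N by rewrite -[1%N in LHS](exp1n 2) subn_sqr.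
rewrite expnS; case: eta_def a_dvd => ->.
  have -> : `|(q%:Z + 1)%R|%N = (q + 1)%N by lia.
  by move=> ?; apply: dvdn_mul => //; rewrite dvdn2 oddB // q_odd.
have -> : `|(q%:Z + -1)%R|%N = (q - 1)%N by lia.
by move=> ?; rewrite mulnC; apply: dvdn_mul => //; rewrite dvdn2 oddD q_odd.
Qed.

(** Each squaring multiplies q ^ k - 1 by the even number q ^ k + 1. *)
Lemma dvdn_exp_pred (q a : nat) (eta : int) al : odd q -> eta = 1 \/ eta = -1 ->
  (2 ^ a %| `|(q%:Z + eta)%R|)%N -> (0 < al)%N -> (2 ^ (a + al) %| q ^ (2 ^ al) - 1)%N.
Proof.
move=> q_odd eta_def a_dvd; elim: al => // -[|al] IHal _.
  by rewrite addn1; apply: dvdn_sqr_pred a_dvd.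
have q_gt0 : (0 < q)%N by case: q q_odd {a_dvd IHal}.
rewrite addnS expnS (expnS 2 al.+1) mulnC (mulnC 2) expnM.
have -> Q : (Q ^ 2 - 1 = (Q - 1) * (Q + 1))%N by rewrite -[1%N in LHS](exp1n 2) subn_sqr.
apply: dvdn_mul; first exact: IHal.
by rewrite dvdn2 oddD oddX q_odd orbT.
Qed.

End TwoPart.

Lemma mulmx_inv_rev (K : fieldType) n (A B : 'M[K]_n) :
  A \in unitmx -> B \in unitmx -> invmx (A *m B) = invmx B *m invmx A.
Proof.
move=> uA uB; have uAB : A *m B \in unitmx by rewrite unitmx_mul uA.
apply: (can_inj (mulKmx uAB)); rewrite mulmxV // mulmxA -(mulmxA A) mulmxV //.
by rewrite mulmx1 mulmxV.
Qed.

Section Frobenius.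
Variables (K : fieldType) (q : nat) (eta : int).
Hypothesis q_odd : odd q.
Hypothesis eta_def : eta = 1 \/ eta = -1.
Variable frob : {rmorphism K -> K}.
Hypothesis frobE : forall x, frob x = x ^+ q.

Local Notation F := (Fmx q eta).

(** F on 1 x 1 matrices, which is also its effect on determinants. *)
Definition scalar_frob (z : K) : K := if eta == 1 then z ^+ q else (z ^+ q)^-1.

Lemma FmxE n (A : 'M[K]_n) : F A
  = if eta == 1 then map_mx frob A else (invmx (map_mx frob A))^T.
Proof.
rewrite /Fmx; have -> : map_mx (fun x => x ^+ q) A = map_mx frob A; last by [].
by apply/matrixP=> i j; rewrite !mxE frobE.
Qed.

Lemma Fmx_unit n (A : 'M[K]_n) : A \in unitmx -> F A \in unitmx.
Proof.
by move=> uA; rewrite FmxE; case: ifP; rewrite ?unitmx_tr ?unitmx_inv map_unitmx.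
Qed.

Lemma FmxM n (A B : 'M[K]_n) : A \in unitmx -> B \in unitmx -> F (A *m B) = F A *m F B.
Proof.
move=> uA uB; rewrite !FmxE map_mxM; case: ifP => // _.
have uA' : map_mx frob A \in unitmx by rewrite map_unitmx.
have uB' : map_mx frob B \in unitmx by rewrite map_unitmx.
by rewrite mulmx_inv_rev // trmx_mul.
Qed.

Lemma Fmx1 n : F (1%:M : 'M[K]_n) = 1%:M.
Proof. by rewrite FmxE map_mx1; case: ifP; rewrite ?invmx1 ?trmx1. Qed.

Lemma FmxV n (A : 'M[K]_n) : A \in unitmx -> F (invmx A) = invmx (F A).
Proof.
move=> uA; have uFA := Fmx_unit uA; apply: (can_inj (mulKmx uFA)).
by rewrite -FmxM ?unitmx_inv // !mulmxV // Fmx1.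
Qed.

Lemma Fmx_tens n1 n2 N (B : 'M[K]_n2) : (n2 * n1)%N = N -> B \in unitmx ->
  F (tens (1%:M : 'M[K]_n1) B : 'M_N) = tens (1%:M : 'M[K]_n1) (F B).
Proof.
move=> eN uB; rewrite !FmxE map_tens // map_mx1; case: ifP => // _.
by rewrite tens_inv // ?map_unitmx // tr_tens // trmx1.
Qed.

Lemma scalar_frob_neq0 z : z != 0 -> scalar_frob z != 0.
Proof. by move=> nz; rewrite /scalar_frob; case: ifP; rewrite ?invr_eq0 expf_neq0. Qed.

Lemma scalar_frobM z z' : scalar_frob (z * z') = scalar_frob z * scalar_frob z'.
Proof. by rewrite /scalar_frob; case: ifP => _; rewrite exprMn ?invfM. Qed.

Lemma scalar_frob1 : scalar_frob 1 = 1.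
Proof. by rewrite /scalar_frob expr1n invr1; case: ifP. Qed.

Lemma scalar_frobX z k : scalar_frob (z ^+ k) = scalar_frob z ^+ k.
Proof. by rewrite /scalar_frob; case: ifP => _; rewrite ?exprVn -!exprM mulnC. Qed.

Lemma scalar_frobN1 : scalar_frob (-1) = -1.
Proof. by rewrite /scalar_frob -signr_odd q_odd invrN1; case: ifP. Qed.

Lemma det_Fmx n (A : 'M[K]_n) : \det (F A) = scalar_frob (\det A).
Proof.
rewrite FmxE /scalar_frob -frobE; case: ifP => _; rewrite ?det_tr ?det_inv det_map_mx //.
Qed.

Lemma Fmx_scalar n (z : K) : z != 0 -> F (z%:M : 'M[K]_n) = (scalar_frob z)%:M.
Proof.
move=> nz; rewrite FmxE map_scalar_mx /= frobE /scalar_frob; case: ifP => // _.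
by rewrite invmx_scalar tr_scalar_mx.
Qed.

Lemma Fmx_diag n (d : 'rV[K]_n) : (forall i, d 0 i != 0) ->
  F (diag_mx d) = diag_mx (\row_i scalar_frob (d 0 i)).
Proof.
move=> nz; rewrite FmxE map_diag_mx /scalar_frob; case: ifP => _.
  by congr diag_mx; apply/rowP=> i; rewrite !mxE frobE.
have u : diag_mx (map_mx frob d) \in unitmx.
  by rewrite unitmxE det_diag unitfE; apply/prodf_neq0 => i _; rewrite mxE fmorph_eq0.
rewrite -[RHS]trmxK tr_diag_mx; congr (_^T); apply: (can_inj (mulKmx u)).
rewrite mulmxV // mulmx_diag; apply/matrixP=> i j; rewrite !mxE frobE.
by rewrite mulfV // expf_neq0.
Qed.

(** For eta = -1 the matrices fixed by F are those preserving a Hermitian form; this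
equation also makes them invertible. *)
Lemma isGL_unitary n (A : 'M[K]_n) : eta != 1 ->
  isGL q eta A <-> A^T *m map_mx frob A = 1%:M.
Proof.
move=> /negPf eta1; rewrite /isGL FmxE eta1; split=> [[uA eA]|eA].
  by rewrite -[in A^T]eA trmxK mulVmx // map_unitmx.
have [uT uA] := mulmx1_unit eA; split; first by rewrite -unitmx_tr.
apply: trmx_inj; rewrite trmxK; apply: (can_inj (mulmxK uA)).
by rewrite mulVmx.
Qed.

Lemma isGLM n (A B : 'M[K]_n) : isGL q eta A -> isGL q eta B -> isGL q eta (A *m B).
Proof.
move=> [uA eA] [uB eB]; split; first by rewrite unitmx_mul uA.
by rewrite FmxM // eA eB.
Qed.

Lemma isGL_monomial (T : finType) n (A : T -> 'M[K]_n) s :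
  (forall i, isGL q eta (A i)) -> isGL q eta (monomial_mx A s).
Proof.
move=> GA; case: (eqVneq eta 1) => [eta1|eta1].
  split; last first.
    rewrite FmxE eta1 eqxx map_monomial; apply: eq_monomial => i.
    by have [_ {2}<-] := GA i; rewrite FmxE eta1 eqxx.
  suff /mulmx1_unit[] : monomial_mx A s *m monomial_mx (fun i =>
    invmx (A ((s^-1)%g i))) (s^-1)%g = 1%:M by [].
  rewrite monomialM mulgV -diag_blocks1; apply: eq_monomial => i.
  by rewrite permK mulmxV //; have [] := GA i.
apply/isGL_unitary => //; rewrite tr_monomial map_monomial monomialM mulVg -diag_blocks1.
by apply: eq_monomial => i; apply/isGL_unitary.
Qed.

Lemma iter_frob_neq0 i z : z != 0 -> iter i scalar_frob z != 0.
Proof. by move=> nz; elim: i => //= i IH; apply: scalar_frob_neq0. Qed.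

Lemma iter_frobM i z z' : iter i scalar_frob (z * z')
  = iter i scalar_frob z * iter i scalar_frob z'.
Proof. by elim: i => //= i ->; rewrite scalar_frobM. Qed.

Lemma iter_frob1 i : iter i scalar_frob 1 = 1.
Proof. by elim: i => //= i ->; rewrite scalar_frob1. Qed.

Lemma iter_frobN1 i : iter i scalar_frob (-1) = -1.
Proof. by elim: i => //= i ->; rewrite scalar_frobN1. Qed.

Lemma scalar_frob2 z : scalar_frob (scalar_frob z) = z ^+ (q ^ 2).
Proof.
by rewrite /scalar_frob; case: (eta == 1); rewrite ?exprVn ?invrK -exprM.
Qed.

Lemma iter_frob_double k z : iter (2 * k) scalar_frob z = z ^+ (q ^ (2 * k)).
Proof.
elim: k => [|k IHk]; first by rewrite muln0 expr1.
by rewrite mulnS iterD IHk /= scalar_frob2 -exprM -expnD addnC.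
Qed.

Definition twopow_root (r : nat) (z : K) := z ^+ (2 ^ r) = 1.

Lemma twopow_root_neq0 r z : twopow_root r z -> z != 0.
Proof.
move=> zr; apply/eqP=> z0; move: zr; rewrite /twopow_root z0 expr0n expn_eq0 /=.
by move/eqP; rewrite eq_sym oner_eq0.
Qed.

(** z is in the cyclic group of order q - eta, and q - eta is twice an odd number since
4 divides q + eta. *)
Lemma scalar_frob_fix r z : (4 %| `|(q%:Z + eta)%R|)%N -> twopow_root r z ->
  scalar_frob z = z -> z ^+ 2 = 1.
Proof.
move=> q_eta zr Fz; have nz := twopow_root_neq0 zr.
have [k k_odd zk] : exists2 k, odd k & z ^+ (2 * k) = 1.
  move: Fz q_eta; rewrite /scalar_frob; case: eta_def => ->; rewrite ?eqxx => zq q4.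
    exists (q.-1./2); first by move: q4 q_odd; lia.
    have -> : (2 * q.-1./2 = q.-1)%N by move: q_odd; lia.
    apply: (mulfI nz); rewrite mulr1 -exprS prednK //.
    by case: q q_odd.
  exists (q.+1./2); first by move: q4 q_odd; lia.
  have -> : (2 * q.+1./2 = q.+1)%N by move: q_odd; lia.
  by rewrite exprS -{1}zq mulVf // expf_neq0.
have gz : z ^+ gcdn (2 ^ r.+1) (2 * k) = 1.
  apply: expr_gcd => //; first by rewrite expn_gt0.
  by rewrite expnSr exprM zr expr1n.
have := gz; rewrite expnS -muln_gcdr (eqP (_ : coprime _ _)) ?muln1 //.
by rewrite coprimeXl // coprime2n.
Qed.

Section Torus.
Variables (al : nat) (gal : 'M[K]_(2 ^ al)).
Hypothesis gal_det : \det gal = 1.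
Hypothesis gal_F : invmx gal *m F gal = cycle_mx (2 ^ al).

Definition orbit_diag (z : K) : 'M[K]_(2 ^ al) := diag_mx (\row_i iter i scalar_frob z).

(** F maps g to g v, where conjugation by v = g^-1 F(g) permutes diagonal matrices
cyclically; so F fixes g diag(z, F z, F^2 z, ...) g^-1 if F^(2 ^ al) fixes z. *)
Definition torus_mx (z : K) : 'M[K]_(2 ^ al) := gal *m orbit_diag z *m invmx gal.

Definition orbit_norm (z : K) := \prod_(i < 2 ^ al) iter i scalar_frob z.

Lemma gal_unit : gal \in unitmx.
Proof. exact: det1_unit. Qed.

Lemma F_gal : F gal = gal *m cycle_mx (2 ^ al).
Proof. by rewrite -gal_F mulKVmx // gal_unit. Qed.

Lemma cycle_unit : (cycle_mx (2 ^ al) : 'M[K]_(2 ^ al)) \in unitmx.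
Proof. by rewrite -gal_F unitmx_mul unitmx_inv gal_unit Fmx_unit // gal_unit. Qed.

Lemma orbit_diag_unit z : z != 0 -> orbit_diag z \in unitmx.
Proof.
move=> nz; rewrite unitmxE det_diag unitfE; apply/prodf_neq0 => i _.
by rewrite mxE iter_frob_neq0.
Qed.

Lemma torus_unit z : z != 0 -> torus_mx z \in unitmx.
Proof. by move=> nz; rewrite !unitmx_mul unitmx_inv gal_unit orbit_diag_unit. Qed.

Lemma torusM z z' : torus_mx z *m torus_mx z' = torus_mx (z * z').
Proof.
rewrite /torus_mx !mulmxA mulmxKV ?gal_unit // -(mulmxA gal) mulmx_diag.
congr (_ *m diag_mx _ *m _); apply/rowP=> i.
by rewrite !mxE iter_frobM.
Qed.

Lemma torus1 : torus_mx 1 = 1%:M.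
Proof.
rewrite /torus_mx; have -> : orbit_diag 1 = 1%:M.
  by apply/matrixP=> i j; rewrite !mxE iter_frob1.
by rewrite mulmx1 mulmxV // gal_unit.
Qed.

Lemma torusN1 : torus_mx (-1) = - 1%:M.
Proof.
rewrite /torus_mx; have -> : orbit_diag (-1) = - 1%:M.
  by apply/matrixP=> i j; rewrite !mxE iter_frobN1 mulNrn.
by rewrite mulmxN mulNmx mulmx1 mulmxV // gal_unit.
Qed.

Lemma torus_inj : injective torus_mx.
Proof.
move=> z z' eqt.
have /matrixP eqd : orbit_diag z = orbit_diag z'.
  apply: (can_inj (mulKmx gal_unit)).
  by apply: (can_inj (mulmxK (_ : invmx gal \in unitmx))); rewrite ?unitmx_inv ?gal_unit.
have k_gt0 : (0 < 2 ^ al)%N by rewrite expn_gt0.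
by have := eqd (Ordinal k_gt0) (Ordinal k_gt0); rewrite !mxE eqxx !mulr1n.
Qed.

Lemma det_torus z : \det (torus_mx z) = orbit_norm z.
Proof.
rewrite !det_mulmx det_inv gal_det invr1 mul1r mulr1 det_diag.
by apply: eq_bigr => i _; rewrite mxE.
Qed.

Lemma F_torus z : z != 0 -> iter (2 ^ al) scalar_frob z = z -> F (torus_mx z) = torus_mx z.
Proof.
move=> nz zk; have ug := gal_unit; have uc := cycle_unit; have ud := orbit_diag_unit nz.
rewrite /torus_mx !FmxM ?unitmx_mul ?ud ?ug ?unitmx_inv // FmxV // F_gal mulmx_inv_rev //.
rewrite -!mulmxA; congr (_ *m _); rewrite !mulmxA; congr (_ *m _).
apply: (can_inj (mulmxK uc)); rewrite mulmxKV //.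
rewrite /orbit_diag Fmx_diag => [|i]; last by rewrite mxE iter_frob_neq0.
rewrite mul_mx_diag mul_diag_mx; apply/matrixP=> i j; rewrite !mxE -iterS.
rewrite mulrBl mulrBr; congr (_ - _); first by case: eqP => [->|_];
  rewrite /= ?mulr1 ?mul1r ?mulr0 ?mul0r.
case: (eqVneq (val i) 0%N) => [->|_]; last by rewrite /= mulr0 mul0r.
case: (eqVneq (val j) (2 ^ al).-1) => [->|_]; last by rewrite /= mulr0 mul0r.
by rewrite /= mulr1 mul1r -iterS prednK ?expn_gt0.
Qed.

Lemma orbit_normM z z' : orbit_norm (z * z') = orbit_norm z * orbit_norm z'.
Proof. by rewrite -big_split; apply: eq_bigr => i _; rewrite iter_frobM. Qed.

Lemma orbit_norm1 : orbit_norm 1 = 1.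
Proof. by rewrite /orbit_norm big1 // => i _; rewrite iter_frob1. Qed.

Lemma orbit_normX z k : orbit_norm (z ^+ k) = orbit_norm z ^+ k.
Proof. by elim: k => [|k IHk]; rewrite ?expr0 ?orbit_norm1 // !exprS orbit_normM IHk. Qed.

Lemma orbit_normN1 : (0 < al)%N -> orbit_norm (-1) = 1.
Proof.
move=> al_gt0; rewrite /orbit_norm (eq_bigr (fun _ => -1)) => [|i _];
  last exact: iter_frobN1.
by rewrite prodr_const card_ord -signr_odd oddX eqn0Ngt al_gt0.
Qed.

(** The norm of z is a determinant, so F fixes it. *)
Lemma orbit_norm_sqr r z : (4 %| `|(q%:Z + eta)%R|)%N -> twopow_root r z ->
  iter (2 ^ al) scalar_frob z = z -> orbit_norm z ^+ 2 = 1.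
Proof.
move=> q_eta zr zk; apply: (scalar_frob_fix (r := r)) => //.
  by rewrite /twopow_root -orbit_normX zr orbit_norm1.
rewrite -[RHS]det_torus -(F_torus (twopow_root_neq0 zr) zk) det_Fmx det_torus //.
Qed.

End Torus.
End Frobenius.

(** * The determinants of the generators *)
Section TwoByTwo.
Variable K : fieldType.

Lemma mx22E (a b c d : K) (i j : 'I_2) :
  mx22 a b c d i j = if i == 0 then if j == 0 then a else b else if j == 0 then c else d.
Proof.
have blkE (k l : 'I_(1 + 1)) : (block_mx a%:M b%:M c%:M d%:M : 'M[K]_(1 + 1)) k l =
    if val k == 0%N then if val l == 0%N then a else b else if val l == 0%N then c else d.
  case: (split_ordP k) => k' ->; case: (split_ordP l) => l' ->;
    rewrite ?(block_mxEul, block_mxEur, block_mxEdl, block_mxEdr) !ord1 !mxE /=;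
    by rewrite mulr1n.
exact: blkE.
Qed.

Lemma mx22M (a b c d a' b' c' d' : K) : mx22 a b c d *m mx22 a' b' c' d' =
  mx22 (a * a' + b * c') (a * b' + b * d') (c * a' + d * c') (c * b' + d * d').
Proof.
apply/matrixP=> i j; rewrite mxE !big_ord_recl big_ord0 addr0 !mx22E /=.
by case: (i == 0); case: (j == 0).
Qed.

Lemma mx22_scalar (z : K) : mx22 z 0 0 z = z%:M.
Proof.
by apply/matrixP=> -[[|[|//]] i2] [[|[|//]] j2]; rewrite mx22E !mxE.
Qed.

Lemma det_mx22 (a b c d : K) : \det (mx22 a b c d) = a * d - b * c.
Proof.
have det2 (M : 'M[K]_2) : \det M = M ord0 ord0 * M (lift ord0 ord0) (lift ord0 ord0)
    - M ord0 (lift ord0 ord0) * M (lift ord0 ord0) ord0.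
  rewrite (expand_det_row _ ord0) !big_ord_recl big_ord0 addr0 /cofactor !det_mx11 !mxE.
  have -> : lift (lift ord0 ord0) 0 = ord0 :> 'I_2 by apply/val_inj.
  have -> : lift ord0 0 = lift ord0 ord0 :> 'I_2 by apply/val_inj.
  by rewrite /= /bump /= expr0 expr1 mul1r mulN1r mulrN.
by rewrite det2 !mx22E.
Qed.

Lemma wmx_sqr : wmx K *m wmx K = - 1%:M.
Proof.
rewrite /wmx mx22M !(mul0r, mulr0, mul1r, mulr1, add0r, addr0) mx22_scalar.
by rewrite raddfN.
Qed.

Lemma xmx_det_sqr : \det (xmx K) ^+ 2 = 1.
Proof. by rewrite det_mx22 mul1r mul0r subr0 sqrrN expr1n. Qed.

Lemma ymx_det_sqr : \det (ymx K) ^+ 2 = 1.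
Proof. by rewrite det_mx22 mul0r mul1r sub0r sqrrN expr1n. Qed.

Lemma wmx_det : \det (wmx K) = 1.
Proof. by rewrite det_mx22 mul0r mul1r sub0r opprK. Qed.

Lemma det_conj1 (g : forall al, 'M[K]_(2 ^ al)) A : \det (g 1%N) = 1 ->
  \det (conj1 g A) = \det A.
Proof. by move=> det_g; rewrite /conj1 !det_mulmx det_inv det_g invr1 mul1r mulr1. Qed.

Lemma det_tens_at_sqr (A : 'M[K]_2) j r : \det A ^+ 2 = 1 -> \det (tens_at A j r) ^+ 2 = 1.
Proof.
move=> dA; elim: r => [|r IHr] /=; first by rewrite det1 expr1n.
rewrite det_tens -?expnS // exprMn IHr expr1n mul1r exprAC.
by case: ifP => _; rewrite ?dA ?det1 ?expr1n.
Qed.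

(** For r > 1 there is a tensor factor I_2, which squares the determinant. *)
Lemma det_tens_at (A : 'M[K]_2) j r : \det A ^+ 2 = 1 -> (1 < r)%N ->
  \det (tens_at A j r) = 1.
Proof.
case: r => // -[//|r] dA _; rewrite [tens_at _ _ _]/= det_tens; last by rewrite -expnS.
rewrite (det_tens_at_sqr j r.+1 dA) mul1r expnS exprM.
by case: ifP => _; rewrite ?dA ?det1 ?expr1n.
Qed.

(** Used for chi the identity and for chi = orbit_norm. *)
Lemma generated_det (chi : K -> K) n (S : 'M[K]_n -> Prop) :
  chi 1 = 1 -> (forall x y, chi (x * y) = chi x * chi y) ->
  (forall A, S A -> A \in unitmx /\ chi (\det A) = 1) ->
  forall A, Defs.generated S A -> A \in unitmx /\ chi (\det A) = 1.
Proof.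
move=> chi1 chiM SP A; elim=> {A} [|A B /SP[uA cA] _ [uB cB]|A B /SP[uA cA] _ [uB cB]].
- by rewrite unitmx1 det1.
- by rewrite unitmx_mul uA uB det_mulmx chiM cA cB mulr1.
rewrite unitmx_mul unitmx_inv uA uB det_mulmx chiM cB mulr1; split=> //.
have nz : \det A != 0 by rewrite -unitfE -unitmxE.
by have := chiM (\det A) (\det A)^-1; rewrite divff // chi1 cA mul1r det_inv.
Qed.

Lemma generated_det1 n (S : 'M[K]_n -> Prop) :
  (forall A, S A -> \det A = 1) -> forall A, Defs.generated S A -> \det A = 1.
Proof.
move=> SP A genA; have [] // := generated_det (chi := id) _ _ _ genA.
by move=> B /SP dB; split=> //; apply: det1_unit.
Qed.

Lemma det_xy_gens m ga r M : (r <= ga)%N -> @xy_gens K m ga r M -> \det M ^+ 2 = 1.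
Proof.
move=> r_le [j /andP[_ j_le] []] ->; rewrite det_tens 1?mulnC // det1 expr1n mul1r exprAC.
  by rewrite det_tens_at_sqr ?expr1n // xmx_det_sqr.
by rewrite det_tens_at_sqr ?expr1n // ymx_det_sqr.
Qed.

Lemma det_xy_gens1 m ga r M : (1 < ga)%N -> @xy_gens K m ga r M -> \det M = 1.
Proof.
move=> ga_gt1 [j _ []] ->; rewrite det_tens 1?mulnC // det1 expr1n mul1r.
  by rewrite det_tens_at ?expr1n // xmx_det_sqr.
by rewrite det_tens_at ?expr1n // ymx_det_sqr.
Qed.

End TwoByTwo.

(** * The basic subgroups *)
Section Cases.
Variables (K : fieldType) (q : nat) (eta : int).
Hypothesis q_odd : odd q.
Hypothesis eta_def : eta = 1 \/ eta = -1.
Variable frob : {rmorphism K -> K}.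
Hypothesis frobE : forall x, frob x = x ^+ q.
Variable a : nat.
Hypothesis a_gt1 : (1 < a)%N.
Hypothesis a_dvd : (2 ^ a %| `|(q%:Z + eta)%R|)%N.
Hypothesis two_neq0 : (2 : K) != 0.
Variables (zeta : nat -> K) (zeta4 : K) (g : forall al : nat, 'M[K]_(2 ^ al)).
Hypothesis zeta_order : forall al, (0 < al)%N -> (2 ^ (a + al)).-primitive_root (zeta al).
Hypothesis zeta4_neq0 : zeta4 != 0.
Hypothesis g_det : forall al, (0 < al)%N -> \det (g al) = 1.
Hypothesis g_F : forall al, (0 < al)%N ->
  invmx (g al) *m Fmx q eta (g al) = cycle_mx (2 ^ al).

Local Notation Fs := (@scalar_frob K q eta).
Local Notation torus al := (@torus_mx K q eta al (g al)).
Local Notation isGL := (isGL q eta).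
Local Notation twopow_root := (@twopow_root K).

Lemma q_eta4 : (4 %| `|(q%:Z + eta)%R|)%N.
Proof. by apply: dvdn_trans a_dvd; rewrite (@dvdn_exp2l 2 2). Qed.

Lemma iter_frob_fix al z : (0 < al)%N -> twopow_root (a + al) z -> iter (2 ^ al) Fs z = z.
Proof.
case: al => // al _ zr; rewrite expnS iter_frob_double -expnS.
have /dvdnP[k ek] := dvdn_exp_pred q_odd eta_def a_dvd (ltn0Sn al).
rewrite -[q in LHS](prednK _); last by case: q q_odd.
rewrite prednK; last by case: q q_odd.
have -> : (q ^ 2 ^ al.+1 = (k * 2 ^ (a + al.+1)).+1)%N.
  by rewrite -ek subn1 prednK // expn_gt0; case: q q_odd.
by rewrite exprS mulnC exprM zr expr1n mulr1.
Qed.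

Lemma orbit_norm_twopow al z : (0 < al)%N -> twopow_root (a + al) z ->
  orbit_norm q eta al z ^+ 2 = 1.
Proof.
move=> al_gt0 zr; apply: (orbit_norm_sqr q_odd eta_def frobE (g_det al_gt0) (g_F al_gt0)
  q_eta4 zr).
exact: iter_frob_fix.
Qed.

Section Torus.
Variables (m al ga : nat).
Hypothesis m_gt0 : (0 < m)%N.
Hypothesis al_gt0 : (0 < al)%N.

Lemma torus_size : (2 ^ al * (m * 2 ^ ga) = m * 2 ^ (al + ga))%N.
Proof. by rewrite mulnCA -expnD. Qed.

Definition torus_block (z : K) : 'M[K]_(m * 2 ^ (al + ga)) :=
  tens (1%:M : 'M_(m * 2 ^ ga)) (torus al z).

Lemma torus_blockM z z' : torus_block z *m torus_block z' = torus_block (z * z').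
Proof. by rewrite /torus_block (tensM torus_size) mulmx1 torusM // g_det. Qed.

Lemma torus_block1 : torus_block 1 = 1%:M.
Proof. by rewrite /torus_block torus1 ?g_det // (tens11 _ torus_size). Qed.

Lemma torus_blockN1 : torus_block (-1) = - 1%:M.
Proof.
rewrite /torus_block torusN1 ?g_det // -(raddfN (@scalar_mx _ _)) (tens_scalar torus_size).
by rewrite raddfN.
Qed.

Lemma torus_block_unit z : z != 0 -> torus_block z \in unitmx.
Proof.
move=> nz; apply: (tens_unit torus_size); first exact: unitmx1.
by apply: torus_unit; rewrite ?g_det.
Qed.

Lemma tens1_inj n1 n2 N (eN : (n2 * n1)%N = N) (B B' : 'M[K]_n2) : (0 < n1)%N ->
  tens (1%:M : 'M[K]_n1) B = tens (1%:M : 'M[K]_n1) B' :> 'M_N -> B = B'.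
Proof.
move=> n1_gt0; case: N / eN; rewrite /tens !conform_mx_id => eqB.
apply/matrixP=> i j; have := congr1 (fun M =>
  block_of M i j (Ordinal n1_gt0) (Ordinal n1_gt0)) eqB.
by rewrite !block_of_tensmx !mxE eqxx !mulr1.
Qed.

Lemma torus_block_inj : injective torus_block.
Proof.
move=> z z' /(tens1_inj torus_size); rewrite muln_gt0 m_gt0 expn_gt0 => /(_ isT).
exact: (torus_inj (g_det al_gt0)).
Qed.

Lemma det_torus_block z : \det (torus_block z) = orbit_norm q eta al z ^+ (m * 2 ^ ga).
Proof.
by rewrite /torus_block (det_tens torus_size) det1 expr1n mul1r det_torus ?g_det.
Qed.

Lemma isGL_torus_block z : twopow_root (a + al) z -> isGL (torus_block z).
Proof.
move=> zr; have nz := twopow_root_neq0 zr; split; first exact: torus_block_unit.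
rewrite /torus_block (Fmx_tens eta frobE torus_size) ?torus_unit ?g_det //.
by rewrite (F_torus frobE (g_det al_gt0) (g_F al_gt0)) // iter_frob_fix.
Qed.

Lemma zeta_twopow : twopow_root (a + al) (zeta al).
Proof. by rewrite /twopow_root (prim_expr_order (zeta_order al_gt0)). Qed.

Lemma twopow_rootP z : twopow_root (a + al) z -> exists k, z = zeta al ^+ k.
Proof.
by move=> zr; have [k ->] := prim_rootP (zeta_order al_gt0) zr; exists k.
Qed.

Lemma zeta_pow4 : zeta al ^+ 4 != 1.
Proof.
rewrite -(prim_order_dvd (zeta_order al_gt0)) (dvdn_Pexp2l _ 2) //.
by rewrite -ltnNge; apply: (leq_add a_gt1 al_gt0).
Qed.

(** F acts on scalar matrices by scalar_frob, so the block diagonal matrix is the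
tensor product of 1 with a diagonal matrix. *)
Lemma Rpos_scalar z : z != 0 ->
  let gg : 'M[K]_(m * 2 ^ (al + ga)) := tens (1%:M : 'M[K]_(m * 2 ^ ga)) (g al) in
  gg *m blockdiag (fun i : 'I_(2 ^ al) =>
    iter i (@Fmx K q eta (m * 2 ^ ga)) z%:M) *m invmx gg
  = torus_block z.
Proof.
move=> nz /=; have iterF i : iter i (@Fmx K q eta (m * 2 ^ ga)) z%:M = (iter i Fs z)%:M.
  elim: i => //= i ->; rewrite (Fmx_scalar eta frobE) // iter_frob_neq0 //.
rewrite (eq_blockdiag _ (fun i => iterF i)) (blockdiag_scalar torus_size).
rewrite (tens_inv torus_size) ?det1_unit ?g_det // !(tensM torus_size) !mulmx1.
by [].
Qed.

(** The determinant is the norm of det A.  For A scalar this is an even power of an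
element of square 1, and for the generators x_j and y_j, of determinant 1 or -1,
it is an even power of that determinant. *)
Lemma det_Rpos M : (0 < ga)%N -> @Rpos K q eta zeta g m al ga M -> \det M = 1.
Proof.
move=> ga_gt0 [A RA ->]; have ugg : (tens (1%:M : 'M[K]_(m * 2 ^ ga)) (g al) : 'M_(m * 2 ^
  (al + ga))) \in unitmx.
  by apply: (tens_unit torus_size); rewrite ?unitmx1 // det1_unit ?g_det.
rewrite !det_mulmx det_inv mulrAC mulfV ?mul1r -?unitfE -?unitmxE //.
rewrite (det_blockdiag torus_size).
have [uA NA] : A \in unitmx /\ orbit_norm q eta al (\det A) = 1.
  apply: (generated_det _ _ _ RA) => [|x y|{M A RA}A [->|xyA]];
    [exact: orbit_norm1|exact: orbit_normM| |].
    have nz : zeta al != 0 by apply: twopow_root_neq0 zeta_twopow.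
    split; first by rewrite unitmxE det_scalar unitfE expf_neq0.
    rewrite det_scalar orbit_normX -(prednK ga_gt0) expnS mulnCA exprM.
    by rewrite orbit_norm_twopow ?expr1n //; apply: zeta_twopow.
  have dA2 := det_xy_gens (leqnn _) xyA.
  split; first by rewrite unitmxE unitfE -sqrf_eq0 dA2 oner_eq0.
  have /eqP := dA2; rewrite sqrf_eq1 => /orP[] /eqP->; first exact: orbit_norm1.
  by rewrite orbit_normN1.
apply: etrans NA; apply: eq_bigr => i _.
suff [] : iter i (@Fmx K q eta (m * 2 ^ ga)) A \in unitmx /\
  \det (iter i (@Fmx K q eta (m * 2 ^ ga)) A) = iter i Fs (\det A) by [].
elim: (val i) => //= k [uk dk]; split; first exact: (Fmx_unit eta frobE).
by rewrite (det_Fmx eta frobE) dk.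
Qed.

End Torus.

(** The two ways in which a basic subgroup R is shown to be special.  In the second
one R is in GL_N(eta q), so that its elements have entries in the field with q ^ 2
elements; this makes its determinant-one part over K the one of the finite group. *)
Definition sl_dichotomy N (R : 'M[K]_N -> Prop) : Prop :=
  (forall M, R M -> \det M = 1) \/
  ((forall M, R M -> isGL M) /\
   forall X, X \in unitmx ->
     (forall M, R M -> \det M = 1 -> R (X *m M *m invmx X)) ->
     (forall M, R M -> \det M = 1 -> R (invmx X *m M *m X)) ->
     forall M, R M -> R (X *m M *m invmx X)).

Lemma sl_dichotomy_ext N (R R' : 'M[K]_N -> Prop) :
  (forall M, R M <-> R' M) -> sl_dichotomy R -> sl_dichotomy R'.
Proof.
move=> eqR [R1|[RG RX]]; first by left=> M /eqR; apply: R1.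
right; split=> [M /eqR|X uX X1 X2 M /eqR RM]; first exact: RG.
apply/eqR; apply: RX => // [M'|M'] /eqR R'M' dM'; apply/eqR; first exact: X1.
exact: X2.
Qed.

Lemma block_wreath_ext T n (D D' : 'M[K]_n -> Prop) (P : {set {perm T}}) M :
  (forall d, D d <-> D' d) -> block_wreath D P M <-> block_wreath D' P M.
Proof.
by move=> eqD; split=> -[A [s [DA Ps ->]]]; exists A, s; split=> // i; apply/eqD.
Qed.

Lemma sl_dichotomy_det1 T n (D : 'M[K]_n -> Prop) (P : {set {perm T}}) :
  ~~ odd n -> (forall d, D d -> \det d = 1) -> sl_dichotomy (block_wreath D P).
Proof.
move=> n_even D1; left=> _ [A [s [DA _ ->]]]; rewrite det_monomial_even // big1 // => i _.
exact: D1.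
Qed.

Lemma block_wreath1_conj T n (D : 'M[K]_n -> Prop) (P : {set {perm T}}) X : X \in unitmx ->
  (forall M, block_wreath D P M -> \det M = 1 -> block_wreath D P (X *m M *m invmx X)) ->
  forall M, block_wreath1 D P M -> block_wreath1 D P (X *m M *m invmx X).
Proof.
move=> uX XS M [RM dM]; split; first exact: XS.
have nz : \det X != 0 by rewrite -unitfE -unitmxE.
by rewrite !det_mulmx dM mulr1 det_inv divff.
Qed.

Lemma block_wreath1_conjV T n (D : 'M[K]_n -> Prop) (P : {set {perm T}}) X : X \in unitmx ->
  (forall M, block_wreath D P M -> \det M = 1 -> block_wreath D P (invmx X *m M *m X)) ->
  forall M, block_wreath1 D P M -> block_wreath1 D P (invmx X *m M *m X).
Proof.
move=> uX XS M [RM dM]; split; first exact: XS.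
have nz : \det X != 0 by rewrite -unitfE -unitmxE.
by rewrite !det_mulmx dM mulr1 det_inv mulVf.
Qed.

Section TorusCases.
Variables (m al : nat).
Hypothesis m_gt0 : (0 < m)%N.
Hypothesis al_gt0 : (0 < al)%N.

Local Notation n := (m * 2 ^ (al + 0))%N.
Local Notation torus_block := (@torus_block m al 0).

Definition torus_group (c : 'M[K]_n) :=
  exists2 z, twopow_root (a + al) z & c = torus_block z.

(** For gamma = 0 the group R_(m,al,0) is the cyclic group of the roots of unity of
order dividing 2 ^ (a + al), embedded in the torus. *)
Lemma Rpos_torus M : @Rpos K q eta zeta g m al 0 M <-> torus_group M.
Proof.
split=> [[A RA ->]|[z /(twopow_rootP al_gt0)[k ->] ->]].
  have [z zr ->] : exists2 z, twopow_root (a + al) z & A = z%:M.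
    have zz := zeta_twopow al_gt0.
    elim: RA => {A} [|A B|A B]; first by exists 1; rewrite // /twopow_root expr1n.
      case=> [->|[j /andP[]]]; last by case: j.
      move=> _ [z zr ->]; exists (zeta al * z); last by rewrite -scalar_mxM.
      by rewrite /twopow_root exprMn zz zr mulr1.
    case=> [->|[j /andP[]]]; last by case: j.
    move=> _ [z zr ->]; exists ((zeta al)^-1 * z); last by rewrite scalar_mxM invmx_scalar.
    by rewrite /twopow_root exprMn exprVn zz zr mulr1 invr1.
  by exists z => //; apply: Rpos_scalar => //; apply: twopow_root_neq0 zr.
have zk : twopow_root (a + al) (zeta al ^+ k).
  by rewrite /twopow_root exprAC zeta_twopow // expr1n.
exists (zeta al ^+ k)%:M; last by apply/esym/Rpos_scalar => //; apply: twopow_root_neq0 zk.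
elim: k {zk} => [|k IHk]; first by rewrite expr0; apply: generated_1.
by rewrite exprS scalar_mxM; apply: generated_M => //; left.
Qed.

Lemma torus_mul c c' : torus_group c -> torus_group c' -> torus_group (c *m c').
Proof.
move=> [z zr ->] [z' zr' ->]; exists (z * z'); last by rewrite torus_blockM.
by rewrite /twopow_root exprMn zr zr' mulr1.
Qed.

Lemma torus_comm c c' : torus_group c -> torus_group c' -> c *m c' = c' *m c.
Proof. by move=> [z zr ->] [z' zr' ->]; rewrite !torus_blockM // mulrC. Qed.

Lemma torus_inv c : torus_group c -> exists2 c', torus_group c' & c' *m c = 1%:M.
Proof.
move=> [z zr ->]; have nz := twopow_root_neq0 zr; exists (torus_block z^-1).
  by exists z^-1 => //; rewrite /twopow_root exprVn zr invr1.
by rewrite torus_blockM // mulVf // torus_block1.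
Qed.

Lemma torus_group1 : torus_group 1%:M.
Proof. by exists 1; rewrite ?torus_block1 // /twopow_root expr1n. Qed.

Lemma torus_groupZ : torus_group (torus_block (zeta al)).
Proof. by exists (zeta al) => //; apply: zeta_twopow. Qed.

Lemma torus_groupN1 : torus_group (- 1%:M).
Proof.
exists (-1); last by rewrite torus_blockN1.
by rewrite /twopow_root -signr_odd oddX /= eqn0Ngt addn_gt0 al_gt0 orbT.
Qed.

Lemma torus_n_gt0 : (0 < n)%N.
Proof. by rewrite muln_gt0 m_gt0 expn_gt0. Qed.

Lemma torus_n_even : ~~ odd n.
Proof. by rewrite oddM oddX addn0 /= eqn0Ngt al_gt0 andbF. Qed.

Lemma det_torus_sqr c : torus_group c -> \det c ^+ 2 = 1.
Proof.
by move=> [z zr ->]; rewrite det_torus_block // exprAC orbit_norm_twopow // expr1n.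
Qed.

Lemma torus_det1 : \det (torus_block (zeta al)) = 1 ->
  forall c, torus_group c -> \det c = 1.
Proof.
move=> d1 c [z /(twopow_rootP al_gt0)[k ->] ->].
by rewrite det_torus_block // orbit_normX exprAC -(det_torus_block m 0 al_gt0) d1 expr1n.
Qed.

Variables (T : finType) (P : {set {perm T}}).
Hypothesis T_gt1 : (1 < #|T|)%N.
Hypothesis P1 : 1%g \in P.
Hypothesis PM : forall s t, s \in P -> t \in P -> (s * t)%g \in P.
Hypothesis P_trans : forall i j, exists2 s, s \in P & s i = j.

(** If the generator of the torus has determinant 1, so has all of D; otherwise its
determinant is -1 and it serves as Z in [block_wreath_conj_large]. *)
Lemma sl_dichotomy_torus (D : 'M[K]_n -> Prop) :
  (forall d, D d -> isGL d) ->
  (forall d, D d -> \det d ^+ 2 = 1) ->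
  (\det (torus_block (zeta al)) = 1 -> forall d, D d -> \det d = 1) ->
  (forall d d', D d -> D d' -> D (d *m d')) ->
  (forall c, torus_group c -> D c) ->
  (forall d c, D d -> torus_group c -> exists2 c', torus_group c' & d *m c = c' *m d) ->
  (forall d, D d -> (d *m d) *m (d *m d) != 1%:M -> torus_group d) ->
  (forall c d, torus_group c -> D d -> (c *m c) *m (c *m c) != 1%:M ->
    c *m d = d *m c -> torus_group d) ->
  sl_dichotomy (block_wreath D P).
Proof.
move=> DG Ddet D1 DM CD CN Dpow Dcent.
have Z2 := det_torus_sqr torus_groupZ; move/eqP: Z2; rewrite sqrf_eq1 => /orP[] /eqP dZ.
  by apply: sl_dichotomy_det1; [exact: torus_n_even | exact: D1].
right; split=> [_ [A [s [DA _ ->]]]|X uX X1 X2 M RM].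
  by apply: (isGL_monomial frobE) => i; apply: DG.
have W : wreath_spec D torus_group P (torus_block (zeta al)).
  split=> //.
  - exact: torus_n_gt0.
  - by move=> d /DG[].
  - exact: torus_group1.
  - exact: torus_mul.
  - exact: torus_comm.
  - exact: torus_inv.
  - by move=> _ [A [s [DA _ ->]]]; apply: det_monomial_sign => i; apply: Ddet.
  - exact: torus_groupZ.
apply: (block_wreath_conj_large W uX (block_wreath1_conj uX X1) (block_wreath1_conjV uX
  X2)) => //.
- move: (zeta_pow4 al_gt0); apply: contra => /eqP;
  rewrite !torus_blockM // -(torus_block1 m 0 al_gt0).
  by move/(torus_block_inj m_gt0 al_gt0) => <-; rewrite -!expr2 -exprM.
- move=> c [z zr ->]; rewrite torus_blockM // -(torus_block1 m 0 al_gt0) =>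
  /(torus_block_inj m_gt0 al_gt0)/eqP.
  rewrite -expr2 sqrf_eq1 => /orP[] /eqP->; first by left.
  by right; rewrite torus_blockN1 // torus_block1.
- split; first exact: torus_groupN1.
  rewrite -(torus_blockN1 m 0 al_gt0) det_torus_block // orbit_normN1 // expr1n //.
Qed.

Lemma sl_dichotomy_Rpos : sl_dichotomy (block_wreath (@Rpos K q eta zeta g m al 0) P).
Proof.
apply: (sl_dichotomy_ext (R := block_wreath torus_group P)) => [M|].
  by apply: block_wreath_ext => d; split=> /Rpos_torus.
apply: sl_dichotomy_torus => //.
- by move=> d [z zr ->]; apply: isGL_torus_block.
- exact: det_torus_sqr.
- exact: torus_det1.
- exact: torus_mul.
- by move=> d c Cd Cc; exists c => //; apply: torus_comm.
Qed.

End TorusCases.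

Section Semidihedral.
Variables (m : nat).
Hypothesis m_gt0 : (0 < m)%N.

Local Notation n := (m * 2 ^ (1 + 0))%N.
Local Notation torus_block := (@torus_block m 1 0).

(** It normalizes the torus for al = 1 and acts on it as F. *)
Definition weyl_block : 'M[K]_n := tens (1%:M : 'M_(m * 2 ^ 0)) (conj1 g (wmx K)).

Lemma orbit_diag1 z : @orbit_diag K q eta 1 z = mx22 z 0 0 (Fs z).
Proof. by apply/matrixP=> -[[|[|//]] i2] [[|[|//]] j2]; rewrite mx22E !mxE. Qed.

Lemma g1_unit : (g 1%N : 'M[K]_2) \in unitmx.
Proof. exact: (det1_unit (g_det (ltn0Sn 0))). Qed.

Lemma conjugM (G A B : 'M[K]_2) : G \in unitmx ->
  (G *m A *m invmx G) *m (G *m B *m invmx G) = G *m (A *m B) *m invmx G.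
Proof. by move=> uG; rewrite !mulmxA (mulmxKV uG). Qed.

Lemma conj1_torus z : twopow_root (a + 1) z ->
  conj1 g (wmx K) *m torus 1%N z = torus 1%N (Fs z) *m conj1 g (wmx K).
Proof.
move=> zr; have FFz : Fs (Fs z) = z := iter_frob_fix (ltn0Sn 0) zr.
have eqw : wmx K *m orbit_diag q eta 1 z = orbit_diag q eta 1 (Fs z) *m wmx K.
  rewrite !orbit_diag1 FFz /wmx; apply: etrans (mx22M _ _ _ _ _ _ _ _) _.
  apply: etrans (esym (mx22M _ _ _ _ _ _ _ _)).
  by rewrite !(mul0r, mulr0, mul1r, mulr1, add0r, addr0, mulrN1, mulN1r).
apply: etrans (conjugM _ _ g1_unit) _; apply: etrans (esym (conjugM _ _ g1_unit)).
exact: (congr1 (fun M : 'M[K]_2 => (g 1%N : 'M[K]_2) *m M *m invmx (g 1%N : 'M[K]_2)) eqw).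
Qed.

Lemma conj1_sqr : conj1 g (wmx K) *m conj1 g (wmx K) = - 1%:M.
Proof.
by rewrite /conj1 (conjugM _ _ g1_unit) wmx_sqr mulmxN mulmx1 mulNmx mulmxV ?g1_unit.
Qed.

Lemma weyl_torus z : twopow_root (a + 1) z ->
  weyl_block *m torus_block z = torus_block (Fs z) *m weyl_block.
Proof.
by move=> zr; rewrite /weyl_block /torus_block !(tensM (torus_size m 1 0)) conj1_torus.
Qed.

Lemma weyl_sqr : weyl_block *m weyl_block = - 1%:M.
Proof.
rewrite /weyl_block (tensM (torus_size m 1 0)) conj1_sqr mulmx1.
by rewrite -(raddfN (@scalar_mx _ _)) (tens_scalar (torus_size m 1 0)) raddfN.
Qed.

Lemma weyl_unit : weyl_block \in unitmx.
Proof.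
suff /mulmx1_unit[] : weyl_block *m (- weyl_block) = 1%:M by [].
by rewrite mulmxN weyl_sqr opprK.
Qed.

Lemma det_weyl : \det weyl_block = 1.
Proof.
by rewrite (det_tens (torus_size m 1 0)) det1 expr1n mul1r det_conj1 ?g_det // wmx_det
  expr1n.
Qed.

Lemma isGL_wmx : isGL (wmx K).
Proof.
have mapw : map_mx frob (wmx K) = wmx K.
  apply/matrixP=> i j; rewrite mxE !mx22E.
  by case: ifP; case: ifP; rewrite ?rmorph0 ?rmorph1 ?rmorphN1.
case: (eqVneq eta 1) => [eta1|eta1]; last first.
  apply/(isGL_unitary frobE) => //; rewrite mapw.
  have -> : (wmx K)^T = - wmx K.
    apply/matrixP=> -[[|[|//]] i2] [[|[|//]] j2];
    by rewrite mxE [RHS]mxE !mx22E /= ?oppr0 ?opprK.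
  by rewrite mulNmx wmx_sqr opprK.
split; first by rewrite unitmxE wmx_det unitr1.
by rewrite (FmxE eta frobE) eta1 eqxx mapw.
Qed.

Lemma cycle_mx2 : cycle_mx 2 = - wmx K.
Proof.
apply/matrixP=> -[[|[|//]] i2] [[|[|//]] j2]; rewrite mxE [RHS]mxE mx22E /=;
  by rewrite ?subr0 ?sub0r ?oppr0 ?opprK ?subrr.
Qed.

Lemma Fmx_conj (G W V : 'M[K]_2) : G \in unitmx -> W \in unitmx -> V \in unitmx ->
  Fmx q eta G = G *m V -> Fmx q eta W = W -> V *m W = W *m V ->
  Fmx q eta (G *m W *m invmx G) = G *m W *m invmx G.
Proof.
move=> uG uW uV FG FW VW.
rewrite !(FmxM eta frobE) ?unitmx_mul ?uG ?uW ?unitmx_inv // (FmxV eta frobE) //.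
by rewrite FG FW mulmx_inv_rev // !mulmxA -(mulmxA G) VW mulmxA (mulmxK uV).
Qed.

Lemma isGL_weyl : isGL weyl_block.
Proof.
have ug := g1_unit; have [uw Fw] := isGL_wmx.
have uc : conj1 g (wmx K) \in unitmx by rewrite !unitmx_mul unitmx_inv ug uw.
split; first exact: weyl_unit.
rewrite /weyl_block (Fmx_tens eta frobE (torus_size m 1 0)) //; congr tens.
apply: (Fmx_conj (V := cycle_mx 2)) => //.
- by rewrite cycle_mx2 -scaleN1r unitmxZ ?unitrN ?unitr1.
- by have gF := g_F (ltn0Sn 0); apply: (can_inj (mulKmx (_ : invmx (g 1%N) \in unitmx)));
    rewrite ?unitmx_inv // [RHS](mulKmx ug).
- by rewrite cycle_mx2 mulNmx mulmxN.
Qed.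

(** Order 2 ^ (a + 2): the cyclic torus of order 2 ^ (a + 1), and a coset of elements of
order 2 or 4. *)
Definition semidihedral (d : 'M[K]_n) :=
  exists2 z, twopow_root (a + 1) z & d = torus_block z \/ d = torus_block z *m weyl_block.

Lemma twopow_root_frob z : twopow_root (a + 1) z -> twopow_root (a + 1) (Fs z).
Proof. by rewrite /twopow_root => zr; rewrite -scalar_frobX zr scalar_frob1. Qed.

Lemma twopow_rootM z z' : twopow_root (a + 1) z -> twopow_root (a + 1) z' ->
  twopow_root (a + 1) (z * z').
Proof. by rewrite /twopow_root => zr zr'; rewrite exprMn zr zr' mulr1. Qed.

Lemma twopow_rootN1 : twopow_root (a + 1) (-1).
Proof. by rewrite /twopow_root -signr_odd oddX /= addn1. Qed.

Lemma weyl_cosetM z z' : twopow_root (a + 1) z' ->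
  (torus_block z *m weyl_block) *m (torus_block z' *m weyl_block)
    = torus_block (- (z * Fs z')).
Proof.
move=> zr'; rewrite -mulmxA (mulmxA weyl_block) (weyl_torus zr') -(mulmxA _ weyl_block)
  weyl_sqr.
by rewrite -(torus_blockN1 m 0 (ltn0Sn 0)) !torus_blockM // mulrA mulrN1.
Qed.

Lemma semidihedralM d d' : semidihedral d -> semidihedral d' -> semidihedral (d *m d').
Proof.
move=> [z zr dE] [z' zr' dE']; have zrF := twopow_root_frob zr'.
case: dE dE' => -> [] ->.
- by exists (z * z'); [exact: twopow_rootM | left; rewrite torus_blockM].
- by exists (z * z'); [exact: twopow_rootM | right; rewrite mulmxA torus_blockM].
- exists (z * Fs z'); first exact: twopow_rootM.
  by right; rewrite -mulmxA weyl_torus // mulmxA torus_blockM.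
- exists (- (z * Fs z')); last by left; rewrite weyl_cosetM.
  by rewrite -mulN1r; apply: twopow_rootM; [exact: twopow_rootN1 | apply: twopow_rootM].
Qed.

Lemma semidihedral_torus c : @torus_group m 1 c -> semidihedral c.
Proof. by move=> [z zr ->]; exists z => //; left. Qed.

Lemma semidihedral_weyl : semidihedral weyl_block.
Proof.
exists 1; first by rewrite /twopow_root expr1n.
by right; rewrite torus_block1 // mul1mx.
Qed.

Lemma Sone_semidihedral M : @Sone K q eta zeta g m 0 M <-> semidihedral M.
Proof.
have torus_semi A : @Rpos K q eta zeta g m 1 0 A -> @torus_group m 1 A.
  by move/(Rpos_torus (ltn0Sn 0)).
split=> [|[z zr ME]].
  elim=> {M} [|A B SA _ DB|A B SA _ DB].
  - by apply: semidihedral_torus; apply: torus_group1.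
  - apply: semidihedralM => //; case: SA => [/torus_semi|->];
    first exact: semidihedral_torus.
    exact: semidihedral_weyl.
  apply: semidihedralM => //; case: SA => [/torus_semi TA|->].
    have [A' TA' eA] := torus_inv (ltn0Sn 0) TA.
    have [uA' uA] := mulmx1_unit eA.
    suff -> : invmx A = A' by apply: semidihedral_torus.
    by apply: (can_inj (mulmxK uA)); rewrite mulVmx.
  suff -> : invmx weyl_block = (- 1%:M) *m weyl_block.
    apply: semidihedralM; last exact: semidihedral_weyl.
    by apply: semidihedral_torus; apply: torus_groupN1.
  apply: (can_inj (mulmxK weyl_unit)); rewrite mulVmx ?weyl_unit //.
  by rewrite -mulmxA weyl_sqr mulNmx mul1mx opprK.
have SZ : @Sone K q eta zeta g m 0 (torus_block z).
  rewrite -[torus_block z]mulmx1; apply: generated_M; last exact: generated_1.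
  by left; apply/Rpos_torus => //; exists z.
case: ME => -> //.
rewrite -[weyl_block]mulmx1; apply: generated_M; last first.
  by apply: generated_M; [right | exact: generated_1].
by left; apply/Rpos_torus => //; exists z.
Qed.

Variables (T : finType) (P : {set {perm T}}).
Hypothesis T_gt1 : (1 < #|T|)%N.
Hypothesis P1 : 1%g \in P.
Hypothesis PM : forall s t, s \in P -> t \in P -> (s * t)%g \in P.
Hypothesis P_trans : forall i j, exists2 s, s \in P & s i = j.

(** An element z w outside the torus has fourth power 1, since its square is
- z F(z) and z F(z) = z ^ (1 + eta q) has order at most 2.  It acts on the torus
as F, whose fixed points have order at most 2. *)
Lemma sl_dichotomy_Sone : sl_dichotomy
  (block_wreath (@Sone K q eta zeta g m 0 : 'M[K]_n -> Prop) P).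
Proof.
apply: (sl_dichotomy_ext (R := block_wreath semidihedral P)) => [M|].
  by apply: block_wreath_ext => d; split=> /Sone_semidihedral.
have al_gt0 : (0 < 1)%N by [].
apply: sl_dichotomy_torus => //.
- move=> d [z zr [] ->]; first exact: isGL_torus_block.
  by apply: (isGLM frobE); [exact: isGL_torus_block | exact: isGL_weyl].
- move=> d [z zr [] ->]; rewrite ?det_mulmx ?det_weyl ?mulr1; apply: (det_torus_sqr al_gt0);
  by exists z.
- move=> d1 d [z zr [] ->]; rewrite ?det_mulmx ?det_weyl ?mulr1;
  apply: (torus_det1 al_gt0 d1);
  by exists z.
- exact: semidihedralM.
- exact: semidihedral_torus.
- move=> d c [z zr dE] Tc; case: dE => ->.
    by exists c => //; apply: (torus_comm al_gt0) => //; exists z.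
  case: Tc => z' zr' ->; exists (torus_block (Fs z')); first by exists (Fs z') => //;
    apply: twopow_root_frob.
  by rewrite -mulmxA weyl_torus // !mulmxA !torus_blockM // mulrC.
- move=> d [z zr [] ->]; first by move=> _; exists z.
  case/negP; rewrite weyl_cosetM // torus_blockM // mulrNN; apply/eqP;
    rewrite -(torus_block1 m 0 al_gt0); congr torus_block.
  have z2k k : z ^+ (k * 2 ^ a) ^+ 2 = 1.
    by rewrite -exprM -mulnA -expnSr -[a.+1]addn1 mulnC exprM zr expr1n.
  rewrite -expr2 /scalar_frob; case: eta_def a_dvd => ->; rewrite ?eqxx.
    have -> : `|(q%:Z + 1)%R|%N = q.+1 by lia.
    by move=> /dvdnP[k ek]; rewrite -exprS ek z2k.
  have -> : `|(q%:Z + -1)%R|%N = (q - 1)%N by lia.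
  move=> /dvdnP[k ek].
  have nz := twopow_root_neq0 zr.
  have eq_q : q = (k * 2 ^ a).+1 by move: q_odd; lia.
  have zq : z ^+ q = z * z ^+ (k * 2 ^ a) by rewrite {1}eq_q exprS.
  by rewrite /= zq invfM mulrA mulfV // mul1r exprVn z2k invr1.
- move=> c d [z zr ->] [z' zr' dE] nz4; case: dE => ->; first by exists z'.
  rewrite -(mulmxA (torus_block z') weyl_block) weyl_torus // !mulmxA !torus_blockM // =>
    /(can_inj (mulmxK weyl_unit)).
  move/(torus_block_inj m_gt0 al_gt0);
    rewrite mulrC => /(mulfI (twopow_root_neq0 zr'))/esym Fz.
  case/negP: nz4; rewrite !torus_blockM // -!expr2.
  by rewrite (scalar_frob_fix q_odd eta_def q_eta4 zr Fz) expr1n torus_block1.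
Qed.

End Semidihedral.

Section AllCases.
Variables (m : nat) (c : seq nat).
Hypothesis m_gt0 : (0 < m)%N.
Hypothesis c_pos : all (leq 1) c.
Hypothesis c_neq0 : c <> [::].

Lemma card_points_gt1 : (1 < #|points c|)%N.
Proof.
rewrite card_points; case: c c_neq0 c_pos => // c1 c' _ /= /andP[c1_gt0 _].
by rewrite -{1}(expn0 2) ltn_exp2l // ltn_addr.
Qed.

(** If m is even, all determinants are 1.  The number 2 ^ |c| of blocks exceeds 4
since c_1 > 1 and c is not (2). *)
Lemma sl_dichotomy_sign :
  (1 < head 0 c)%N -> c <> [:: 2%N] ->
  sl_dichotomy (block_wreath (@Rbase K q eta zeta g m 0 0) (Aseq c)).
Proof.
case: c c_neq0 c_pos => // c1 c' _ /= /andP[_ c'_pos] c1_gt1 c_neq2.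
set n := (m * 2 ^ (0 + 0))%N; have n_gt0 : (0 < n)%N by rewrite muln_gt0 m_gt0.
apply: (sl_dichotomy_ext (R := block_wreath (@sign_group K n) (Aseq (c1 :: c')))) => [M|].
  apply: block_wreath_ext => d; split=> [[[]]|[]] ->; [by right | by left | |].
  - by exists false.
  - by exists true.
have detN1 : \det (- 1%:M : 'M[K]_n) = (-1) ^+ n.
  by rewrite -scaleN1r detZ det1 mulr1.
have sign_det_sqr d : @sign_group K n d -> \det d ^+ 2 = 1.
  by case=> -[] -> /=; rewrite ?detN1 ?det1 ?expr1n // exprAC sqrrN !expr1n.
case: (boolP (odd n)) => n_odd; last first.
  apply: sl_dichotomy_det1 => // d [[] ->]; rewrite /= ?det1 // detN1.
  by rewrite -signr_odd (negPf n_odd).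
right; split=> [_ [A [s [DA _ ->]]]|X uX X1 X2 M RM].
  apply: (isGL_monomial frobE) => i; case: (DA i) => -[] -> /=; last first.
    by split; [exact: unitmx1 | exact: (Fmx1 eta frobE)].
  have nz : (-1 : K) != 0 by rewrite oppr_eq0 oner_eq0.
  rewrite -(raddfN (@scalar_mx _ _)); split;
    first by rewrite unitmxE det_scalar unitrX // unitfE.
  by rewrite (Fmx_scalar eta frobE) // scalar_frobN1.
have W : wreath_spec (@sign_group K n) (@sign_group K n) (Aseq (c1 :: c')) (- 1%:M).
  split=> //.
  - by move=> d Cd; rewrite unitmxE unitfE -sqrf_eq0 sign_det_sqr // oner_eq0.
  - by move=> d d' [b ->] [b' ->]; exists (b (+) b'); rewrite sign_mxM.
  - by exists false.
  - by move=> d d' [b ->] [b' ->]; exists (b (+) b'); rewrite sign_mxM.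
  - by move=> d d' [b ->] [b' ->]; rewrite !sign_mxM addbC.
  - by move=> d [b ->]; exists (sign_mx K n b); [exists b | rewrite sign_mxM addbb].
  - by move=> d d' [b ->] [b' ->]; exists (sign_mx K n b');
    [exists b' | rewrite !sign_mxM addbC].
  - exact: Aseq1.
  - by move=> s t; apply: AseqM.
  - by move=> _ [A [s [DA _ ->]]]; apply: det_monomial_sign => i; apply: sign_det_sqr.
  - by exists true.
  - by rewrite detN1 -signr_odd n_odd.
have T_gt4 : (4 < #|points (c1 :: c')|)%N.
  rewrite card_points (@ltn_exp2l 2 2) //=.
  case: c' c'_pos c_neq2 {X X1 X2 M RM uX W} => [|c2 c''] /=.
    by move=> _; case: c1 c1_gt1 => [|[|[|]]] // _; rewrite addn0.
  by move=> /andP[c2_gt0 _] _; apply: (leq_trans (leq_add c1_gt1 c2_gt0));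
    rewrite leq_add2l leq_addr.
apply: (block_wreath_conj_sign W c1_gt1 T_gt4 _ _ _ uX (block_wreath1_conj uX X1)
  (block_wreath1_conjV uX X2)) => //.
- exact: Aseq_form.
- exact: Aseq_transl.
- by move=> i j; apply: (@Aseq_trans (c1 :: c') i j).
Qed.

Lemma det_conj_gen ga A M : (0 < ga)%N -> \det A = 1 ->
  M = tens (1%:M : 'M[K]_(m * 2 ^ ga.-1)) (conj1 g A) :> 'M_(m * 2 ^ ga) -> \det M = 1.
Proof.
move=> ga_gt0 dA ->; rewrite det_tens; last by rewrite mulnCA -expnS prednK.
by rewrite det1 expr1n mul1r det_conj1 ?g_det // dA expr1n.
Qed.

Lemma det_Rplus ga M : (1 < ga)%N -> @Rplus K m ga M -> \det M = 1.
Proof. by move=> ga_gt1; apply: generated_det1 => A; apply: det_xy_gens1. Qed.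

(** A generator x_j or y_j exists only if gamma > 1, and then has determinant 1. *)
Lemma det_Rminus ga M : (0 < ga)%N -> @Rminus K zeta4 g m ga M -> \det M = 1.
Proof.
move=> ga_gt0; apply: generated_det1 => A [[j j_le xyA]||].
- apply: (det_xy_gens1 (m := m) (r := ga.-1)); last by exists j.
  by move: j_le => /andP[j_gt0 j_le]; rewrite -ltn_predRL (leq_trans j_gt0).
- by apply: det_conj_gen => //; rewrite det_mx22 mulr0 subr0 mulfV.
- by apply: det_conj_gen => //; apply: wmx_det.
Qed.

Lemma det_Sone ga M : (0 < ga)%N -> @Sone K q eta zeta g m ga M -> \det M = 1.
Proof.
move=> ga_gt0; apply: generated_det1 => A [RA|];
  first exact: (det_Rpos (ltn0Sn 0) ga_gt0 RA).
by move=> eA; apply: (det_conj_gen (ga := ga.+1) _ (wmx_det K) eA).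
Qed.

Lemma odd_block ga : (0 < ga)%N -> ~~ odd (m * 2 ^ ga).
Proof. by move=> ga_gt0; rewrite oddM oddX /= eqn0Ngt ga_gt0 andbF. Qed.

Lemma sl_dichotomy_basic t : admissible t c -> ~ (t = Unsigned 0 0 /\ c = [:: 2%N]) ->
  sl_dichotomy (block_wreath (@basic0 K q eta zeta zeta4 g m t) (Aseq c)).
Proof.
have T_gt1 := card_points_gt1.
have AM s t' : s \in Aseq c -> t' \in Aseq c -> (s * t')%g \in Aseq c by apply: AseqM.
case: t => [[|al] [|ga]|ga|ga] /= adm ne.
- apply: sl_dichotomy_sign => [|c2]; last by apply: ne.
  have : head 0%N c <> 1%N by move=> c1; apply: adm.
  by case: c c_pos c_neq0 => // -[|[|c1]].
- case: ga adm ne => [|ga] _ _; first by apply: sl_dichotomy_Sone => //;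
  [exact: Aseq1 | exact: Aseq_trans].
  by apply: sl_dichotomy_det1; [exact: odd_block | move=> d; apply: det_Sone].
- by apply: sl_dichotomy_Rpos => //; [exact: Aseq1 | exact: Aseq_trans].
- by apply: sl_dichotomy_det1; [exact: odd_block | move=> d; apply: det_Rpos].
- by apply: sl_dichotomy_det1; [apply: odd_block; apply: ltnW | move=> d; apply: det_Rplus].
- by apply: sl_dichotomy_det1; [exact: odd_block | move=> d; apply: det_Rminus].
Qed.

End AllCases.

End Cases.

(** * From matrices over the closure to the finite group *)
Section FiniteField.
Variables (L : finFieldType) (K : fieldType) (iota : {rmorphism L -> K}).

(** X^|L| - X splits over L, so its roots in K come from L. *)
Lemma fixed_in_image (x : K) : x ^+ #|L| = x -> exists y, iota y = x.
Proof.
move=> xL; have := congr1 (map_poly iota) (finField_genPoly L).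
rewrite rmorphB /= map_polyXn map_polyX rmorph_prod /= => /(congr1 (fun p => p.[x])).
rewrite !hornerE xL subrr horner_prod => /esym/eqP.
rewrite prodf_seq_eq0 => /hasP[y _ /=]; rewrite rmorphB /= map_polyX map_polyC /= !hornerE.
by rewrite subr_eq0 => /eqP->; exists y.
Qed.

Lemma pchar_finField (p k : nat) : prime p -> #|L| = (p ^ k)%N -> p \in [pchar K].
Proof.
move=> p_pr cardL; rewrite inE p_pr /=.
have : (1 : L) *+ #|L| = 0.
  by rewrite -FinRing.zmodXgE -cardsT -[RHS]/1%g; apply: expg_cardG; rewrite inE.
rewrite cardL natrX => /eqP; rewrite expf_eq0 => /andP[_ /eqP p0].
by rewrite -(rmorph_nat iota) p0 rmorph0.
Qed.

Lemma exists_frob (p k : nat) : p \in [pchar K] ->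
  exists frob : {rmorphism K -> K}, forall x, frob x = x ^+ (p ^ k).
Proof.
move=> chp; elim: k => [|k [h hE]].
  by exists (GRing.RMorphism.clone _ _ (@idfun K) _) => x.
exists (GRing.RMorphism.clone _ _ (pFrobenius_aut chp \o h) _) => x /=.
by rewrite pFrobenius_autE hE -exprM expnSr.
Qed.

End FiniteField.

Section Group.
Variables (K : fieldType) (q : nat) (eta : int).
Variable frob : {rmorphism K -> K}.
Hypothesis frobE : forall x, frob x = x ^+ q.
Variables (L : finFieldType) (iota : {rmorphism L -> K}).
Hypothesis card_L : #|L| = (q ^ 2)%N.

Lemma isGL_frob2 n (M : 'M[K]_n) : isGL q eta M -> map_mx frob (map_mx frob M) = M.
Proof.
case: (eqVneq eta 1) => [eta1|eta1].
  by case=> _; rewrite (FmxE eta frobE) eta1 eqxx => eM; rewrite !eM.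
move/(isGL_unitary frobE _ eta1) => eM.
have := congr1 (map_mx frob) eM; rewrite map_mxM -map_trmx map_mx1 => eM2.
have := congr1 trmx eM; rewrite trmx_mul trmxK trmx1 => eM3.
have [uM _] := mulmx1_unit eM3.
by apply: (can_inj (mulKmx uM)); rewrite eM2 eM3.
Qed.

Lemma isGL_lift n (M : 'M[K]_n) : isGL q eta M -> exists M0, M = map_mx iota M0.
Proof.
move=> GM; have ex i j : exists y, iota y = M i j.
  apply: fixed_in_image; rewrite card_L.
  have /matrixP/(_ i j) := isGL_frob2 GM.
  by rewrite !mxE !frobE -exprM.
have ex2 i : exists f : 'I_n -> L, forall j, iota (f j) = M i j.
  by have [f fE] := fin_all_exists (ex i); exists f.
have [f fE] := fin_all_exists ex2.
by exists (\matrix_(i, j) f i j); apply/matrixP=> i j; rewrite !mxE fE.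
Qed.

Lemma inGLP n (D : 'M[K]_n.+1 -> Prop) (u : {'GL_n.+1[L]}) :
  u \in inGL iota D <-> D (map_mx iota (GLval u)).
Proof. by rewrite inE conform_mx_id; split=> /asboolP. Qed.

(** If R is not contained in the special linear group, the matrices of determinant 1
in R lift to the finite group, and the second alternative shows that R and its
determinant-one part have the same normalizer. *)
Lemma radical_special N (R : 'M[K]_N -> Prop) : (0 < N)%N -> sl_dichotomy q eta R ->
  let G := inGL iota (isGL q eta : 'M[K]_N -> Prop) in
  let H := inGL iota (isSL q eta : 'M[K]_N -> Prop) in
  radical2 G (inGL iota R) -> special2 G H (inGL iota R).
Proof.
case: N R => // n R _ setR G H radR; split=> //.
have [gR sRG pR eR] := radR; set RL := inGL iota R in radR gR sRG pR eR *.
pose phi (u : {'GL_n.+1[L]}) : 'M[K]_n.+1 := map_mx iota (GLval u).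
have RLP u : u \in RL <-> R (phi u) by apply: inGLP.
have GP u : u \in G <-> isGL q eta (phi u) by apply: inGLP.
have HP u : u \in H <-> isSL q eta (phi u) by apply: inGLP.
have RH u : u \in RL -> (u \in H) <-> \det (phi u) = 1.
  by move=> Ru; split=> [/HP[]|du]; last by apply/HP; split=> //; apply/GP/(subsetP sRG).
have phiM u v : phi (u * v)%g = phi u *m phi v by rewrite /phi GL_MxE map_mxM.
have phiV u : phi (u^-1)%g = invmx (phi u) by rewrite /phi GL_VxE map_invmx.
have phi_unit u : phi u \in unitmx by rewrite /phi map_unitmx; exact: (valP u).
have phiJ u x : phi (u ^ x)%g = invmx (phi x) *m phi u *m phi x.
  by rewrite conjgE !phiM phiV mulmxA.
have detJ u x : \det (phi (u ^ x)%g) = \det (phi u).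
  rewrite phiJ !det_mulmx det_inv mulrAC mulVf ?mul1r //.
  by rewrite -unitfE -unitmxE.
have normP (A : {set {'GL_n.+1[L]}}) x : reflect (forall u, u \in A ->
  (u ^ x)%g \in A) (x \in 'N(A))%g.
  rewrite inE; apply: (iffP subsetP) => [sub u Au|sub _ /imsetP[u Au ->]]; last exact: sub.
  by apply: sub; rewrite memJ_conjg.
suff <- : 'N_G(RL)%g = 'N_G(RL :&: H)%g by [].
case: setR => [R1|[RG RX]].
  suff -> : RL :&: H = RL by [].
  apply/setIidPl/subsetP=> u Ru; apply/RH => //; apply: R1.
  exact/RLP.
apply/setP=> x; rewrite !in_setI; congr (_ && _).
apply/idP/idP=> [/normP Nx|Nx].
  apply/normP=> u /setIP[Ru Hu]; have Rux := Nx u Ru.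
  by apply/setIP; split=> //; apply/RH; rewrite // detJ; apply/RH.
have Nx' : (x^-1)%g \in ('N(RL :&: H))%g by rewrite groupV.
have lift M : R M -> \det M = 1 -> exists2 u, u \in RL :&: H & phi u = M.
  move=> RM dM; have [M0 eM] := isGL_lift (RG M RM).
  have [uM _] := RG M RM.
  have uM0 : M0 \is a GRing.unit by rewrite eM map_unitmx in uM.
  pose u : {'GL_n.+1[L]} := Sub M0 uM0; have phiu : phi u = M by rewrite eM.
  have Ru : u \in RL by apply/RLP; rewrite phiu.
  by exists u => //; apply/setIP; split=> //; apply/RH => //; rewrite phiu.
have conjR y : y \in ('N(RL :&: H))%g -> forall M, R M -> \det M = 1 ->
    R (invmx (phi y) *m M *m phi y).
  move=> /normP Ny M RM dM; have [u RHu <-] := lift M RM dM.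
  by rewrite -phiJ; apply/RLP; have /setIP[] := Ny u RHu.
apply/normP=> u /RLP Ru; apply/RLP; rewrite phiJ -{2}[phi x]invmxK.
apply: RX => //; first by rewrite unitmx_inv.
  by move=> M RM dM; rewrite invmxK; apply: conjR.
move=> M RM dM; rewrite -phiV; have := conjR _ Nx' M RM dM.
by rewrite phiV.
Qed.

End Group.

Lemma sl_dichotomy_wreath_mx (K : fieldType) (q : nat) (eta : int) n N (T : finType)
    (D : 'M[K]_n -> Prop) (P : {set {perm T}}) : (#|T| * n)%N = N ->
  sl_dichotomy q eta (block_wreath D P) ->
  sl_dichotomy q eta (wreath_mx D P : 'M[K]_N -> Prop).
Proof.
case: N /; apply: sl_dichotomy_ext => M; rewrite /block_wreath.
split=> [[A [s [DA Ps ->]]]|[A [s [DA Ps ->]]]].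
  by exists (fun i => A (enum_val i)), s; rewrite monomial_mx.unlock.
exists (fun t => A (enum_rank t)), s; split=> //; rewrite monomial_mx.unlock;
  congr (_ *m _).
by apply: eq_blockdiag => i; rewrite enum_valK.
Qed.

Theorem proposition4p42
    (p f q : nat) (p_prime : prime p) (p_odd : odd p)
    (f_gt0 : (0 < f)%N) (q_def : q = (p ^ f)%N)
    (eta : int) (eta_def : eta = 1 \/ eta = -1)
    (q_eta : (4 %| q%:Z + eta)%Z)
    (a : nat) (a_def : (2 ^ a)%N = (`|(q%:Z + eta)%R|`_2)%N)
    (* Fbar is an algebraic closure of Fq *)
    (Fq : finFieldType) (card_Fq : #|Fq| = q)
    (Fbar : closedFieldType) (iota : {rmorphism Fq -> Fbar})
    (Fbar_alg : integralRange iota)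
    (* L is the subfield of order q ^ 2 of Fbar *)
    (L : finFieldType) (card_L : #|L| = (q ^ 2)%N)
    (iotaL : {rmorphism L -> Fbar})
    (* the choices made in the construction of the basic subgroups *)
    (zeta : nat -> Fbar)
    (zeta_order : forall al, (0 < al)%N ->
       (2 ^ (a + al)).-primitive_root (zeta al))
    (zeta4 : Fbar) (zeta4_order : 4.-primitive_root zeta4)
    (g : forall al : nat, 'M[Fbar]_(2 ^ al))
    (g_det : forall al, (0 < al)%N -> \det (g al) = 1)
    (g_F : forall al, (0 < al)%N ->
       invmx (g al) *m Fmx q eta (g al) = cycle_mx (2 ^ al))
    (m : nat) (m_gt0 : (0 < m)%N)
    (c : seq nat) (c_pos : all (leq 1) c) (c_neq0 : c <> [::])
    (t : basic_type) (t_adm : admissible t c) :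
  let N := (m * 2 ^ (two_exponent t + sumn c))%N in
  let G : {set {'GL_N[L]}} := inGL iotaL (isGL q eta) in
  let H : {set {'GL_N[L]}} := inGL iotaL (isSL q eta) in
  let R : {set {'GL_N[L]}} := inGL iotaL (basic q eta zeta zeta4 g m t c) in
  radical2 G R ->
  ~ (t = Unsigned 0 0 /\ c = [:: 2%N]) ->
  special2 G H R.
Proof.
move=> N G H R radR ne.
have q_odd : odd q by rewrite q_def oddX p_odd orbT.
have chp : p \in [pchar Fbar] by apply: (pchar_finField iota p_prime (k := f));
  rewrite card_Fq.
have [frob frobE] := exists_frob f chp; rewrite -q_def in frobE.
have zeta4_sqr : zeta4 ^+ 2 = -1.
  have : (zeta4 ^+ 2) ^+ 2 == 1 by rewrite -exprM (prim_expr_order zeta4_order).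
  rewrite sqrf_eq1 => /orP[|/eqP//].
  by rewrite -(prim_order_dvd zeta4_order).
have two_neq0 : (2 : Fbar) != 0.
  apply/eqP=> two0; have : (4 %| 2)%N = (zeta4 ^+ 2 == 1) := prim_order_dvd zeta4_order 2.
  by rewrite zeta4_sqr -subr_eq0 -opprD oppr_eq0 -[1 + 1]/(2 : Fbar) two0 eqxx.
have zeta4_neq0 : zeta4 != 0.
  apply/eqP=> z0; move: zeta4_sqr; rewrite z0 expr0n /= => /eqP.
  by rewrite eq_sym oppr_eq0 oner_eq0.
have q4 : (4 %| `|(q%:Z + eta)%R|)%N by [].
have qeta_gt0 : (0 < `|(q%:Z + eta)%R|)%N.
  have q_gt1 : (1 < q)%N by rewrite q_def -(expn0 p) ltn_exp2l // prime_gt1.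
  by move: q_gt1; case: eta_def => ->; lia.
have a_dvd : (2 ^ a %| `|(q%:Z + eta)%R|)%N by rewrite a_def dvdn_part.
have a_gt1 : (1 < a)%N.
  rewrite -(@leq_exp2l 2 2) // a_def p_part leq_exp2l //.
  by rewrite -(@pfactor_dvdn 2 2).
have N_gt0 : (0 < N)%N by rewrite muln_gt0 m_gt0 expn_gt0.
apply: (radical_special frobE card_L N_gt0) radR.
apply: sl_dichotomy_wreath_mx.
  by rewrite card_points mulnCA -expnD addnC.
exact: (sl_dichotomy_basic q_odd eta_def frobE a_gt1 a_dvd two_neq0 zeta_order zeta4_neq0
  g_det g_F).
Qed.
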